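(* Let $(R,\mathfrak{m}_R,k)$, $(S,\mathfrak{m}_S,k)$ and $(T,\mathfrak{m}_T,k)$ be local rings of prime characteristic $p>0$ with the same residue field $k$, let $\epsilon_R:R\to T$ and $\epsilon_S:S\to T$ be surjective ring homomorphisms, and let $s>0$ be a real number. If $\dim(R)>\dim(S)>\dim(T)$ and $R$ is Cohen-Macaulay, then $$e_s(R\times_T S)\geq 1.$$
   Context: All rings are commutative, Noetherian, local, with identity. The fiber product is $R\times_T S=\{(r,s)\in R\times S:\epsilon_R(r)=\epsilon_S(s)\}$; it is a Noetherian local ring with maximal ideal $\mathfrak{m}=\mathfrak{m}_R\times_{\mathfrak{m}_T}\mathfrak{m}_S$ and residue field $k$, of characteristic $p$, with $\dim(R\times_T S)=\max\{\dim R,\dim S\}$. $s$-multiplicity: let $(A,\mathfrak{n})$ be a local ring of prime characteristic $p>0$ and dimension $d>0$, let $I,J$ be $\mathfrak{n}$-primary ideals, $N$ a finitely generated $A$-module, $s>0$ real. Put $$h_s(I,J;N)=\lim_{e\to\infty}\frac{\ell_A\big(N/(I^{\lceil sp^e\rceil}+J^{[p^e]})N\big)}{p^{ed}},$$ where $\ell_A$ is length and $J^{[p^e]}$ is the ideal generated by the $p^e$-th powers of elements of $J$ (the limit is known to exist), and $$e_s(I,J;N)=\frac{h_s(I,J;N)}{\mathcal{H}_s(d)},\qquad \mathcal{H}_s(d)=\sum_{i=0}^{\lfloor s\rfloor}\frac{(-1)^i}{d!}\binom{d}{i}(s-i)^d .$$ For a local ring $(A,\mathfrak{n})$, $e_s(A):=e_s(\mathfrak{n},\mathfrak{n};A)$.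 *)

(* Defs.v *)
From HB Require Import structures.
From mathcomp Require Import all_boot all_order all_algebra.
From mathcomp Require Import all_classical all_reals all_analysis.
Set Implicit Arguments.
Unset Strict Implicit.
Unset Printing Implicit Defensive.
Import Order.TTheory GRing.Theory Num.Theory.
Import numFieldNormedType.Exports.
Local Open Scope classical_set_scope.
Local Open Scope ring_scope.

(* Ideals and submodules are classical sets.  An ideal of [A] is a submodule of
   the regular module [A^o] and may be improper; the library's [idealr_closed]
   additionally requires properness. *)
Definition submodule (A : comNzRingType) (V : lmodType A) (L : set V) : Prop :=
  submod_closed [in L].

Definition ideal (A : comNzRingType) (I : set A) : Prop :=
  @submodule A A^o I.

Definition submod_span (A : comNzRingType) (V : lmodType A) (X : set V) :
    set V :=
  smallest (@submodule A V) X.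

Definition ideal_span (A : comNzRingType) (X : set A) : set A :=
  @submod_span A A^o X.

Definition submod_scale (A : comNzRingType) (V : lmodType A)
    (I : set A) (L : set V) : set V :=
  submod_span [set a *: x | a in I & x in L].

Definition ideal_mul (A : comNzRingType) (I J : set A) : set A :=
  @submod_scale A A^o I J.

Definition ideal_pow (A : comNzRingType) (I : set A) (n : nat) : set A :=
  iter n (ideal_mul I) [set: A].

Definition frobenius_pow (A : comNzRingType) (J : set A) (q : nat) : set A :=
  ideal_span [set x ^+ q | x in J].

Definition ideal_add (A : comNzRingType) (I J : set A) : set A :=
  [set x + y | x in I & y in J].

Definition strict_chain (V : Type) (C : set (set V)) (n : nat) : Prop :=
  exists c : nat -> set V,
    (forall i, (i <= n)%N -> C (c i)) /\
    (forall i, (i < n)%N -> c i `<` c i.+1).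

(* Greatest element of a set of naturals; [0] if there is none. *)
Definition max_nat (P : set nat) : nat :=
  xget 0%N [set n | P n /\ forall m, P m -> (m <= n)%N].

Definition prime_ideal (A : comNzRingType) (P : set A) : Prop :=
  idealr_closed [in P] /\ prime_idealr_closed [in P].

Definition maximal_ideal (A : comNzRingType) (m : set A) : Prop :=
  idealr_closed [in m] /\
  forall I : set A, idealr_closed [in I] -> m `<=` I -> I = m.

Definition noetherian (A : comNzRingType) : Prop :=
  forall I : set A, ideal I ->
    exists2 X : set A, finite_set X & I = ideal_span X.

(* [pi] induces an isomorphism from [A / m] to [k]. *)
Definition residue_field (A : comNzRingType) (m : set A) (k : fieldType) :
    Prop :=
  exists pi : {rmorphism A -> k},
    set_surj [set: A] [set: k] pi /\ m = [set a | pi a = 0].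

(* [(A, m, k)] is a Noetherian local ring. *)
Definition local_ring (A : comNzRingType) (m : set A) (k : fieldType) : Prop :=
  [/\ noetherian A,
      maximal_ideal m,
      (forall m' : set A, maximal_ideal m' -> m' = m) &
      residue_field m k].

Definition krull_dim (A : comNzRingType) : nat :=
  max_nat (strict_chain (@prime_ideal A)).

(* [xs`_i] is a nonzerodivisor on [A / (xs`_0, ..., xs`_(i-1))], and
   [A / (xs)] is nonzero. *)
Definition regular_seq (A : comNzRingType) (xs : seq A) : Prop :=
  (forall i a, (i < size xs)%N ->
     ideal_span [set` take i xs] (xs`_i * a) ->
     ideal_span [set` take i xs] a) /\
  ~ ideal_span [set` xs] 1.

Definition depth (A : comNzRingType) (m : set A) : nat :=
  max_nat [set n | exists xs : seq A,
    [/\ size xs = n, [set` xs] `<=` m & regular_seq xs]].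

Definition cohen_macaulay (A : comNzRingType) (m : set A) : Prop :=
  depth m = krull_dim A.

(* The length of the quotient module [V / L]: its submodules correspond to the
   submodules of [V] containing [L]. *)
Definition quot_length (F : realType) (A : comNzRingType) (V : lmodType A)
    (L : set V) : \bar F :=
  ereal_sup [set (n%:R)%:E | n in
    strict_chain [set M : set V | submodule M /\ L `<=` M]].

Definition hs_seq (F : realType) (p : nat) (s : F) (A : comNzRingType)
    (I J : set A) (N : lmodType A) (e : nat) : \bar F :=
  (quot_length F
     (submod_scale
        (ideal_add (ideal_pow I `|Num.ceil (s * (p ^ e)%:R)|%N)
                   (frobenius_pow J (p ^ e)))
        [set: N]) *
   (((p ^ (e * krull_dim A))%:R)^-1)%:E)%E.

Definition is_h_s (F : realType) (p : nat) (s : F) (A : comNzRingType)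
    (I J : set A) (N : lmodType A) (h : F) : Prop :=
  hs_seq p s I J N @ \oo --> h%:E.

Definition H_s (F : realType) (s : F) (d : nat) : F :=
  \sum_(0 <= i < (Num.truncn s).+1)
    (-1) ^+ i / (d`!)%:R * ('C(d, i))%:R * (s - i%:R) ^+ d.

(* [e_s(I, J; N) = v].  The limit defining [h_s] always exists for proper
   parameters, so this determines [v]; it is a relation because the value of
   [lim] is only meaningful together with a proof of convergence. *)
Definition is_e_s (F : realType) (p : nat) (s : F) (A : comNzRingType)
    (I J : set A) (N : lmodType A) (v : F) : Prop :=
  exists2 h : F, is_h_s p s I J N h & v = h / H_s s (krull_dim A).

(* [e_s(A) = v] for the local ring [(A, m)]. *)
Definition is_s_multiplicity (F : realType) (p : nat) (s : F)
    (A : comNzRingType) (m : set A) (v : F) : Prop :=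
  is_e_s p s m m A^o v.

Definition fiber_pred (R S T : comNzRingType)
    (epsR : {rmorphism R -> T}) (epsS : {rmorphism S -> T}) : {pred R * S} :=
  [pred x | epsR x.1 == epsS x.2].

Lemma fiber_subring_closed (R S T : comNzRingType)
    (epsR : {rmorphism R -> T}) (epsS : {rmorphism S -> T}) :
  subring_closed (fiber_pred epsR epsS).
Proof.
split=> [|x y /eqP xE /eqP yE|x y /eqP xE /eqP yE]; apply/eqP.
- by rewrite /= !rmorph1.
- by rewrite /= !rmorphB /= xE yE.
- by rewrite /= !rmorphM /= xE yE.
Qed.

Record fiber_product (R S T : comNzRingType)
    (epsR : {rmorphism R -> T}) (epsS : {rmorphism S -> T}) : Type :=
  FiberProduct {
    fiber_val : R * S;
    fiber_valP : fiber_val \in fiber_pred epsR epsS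
  }.

HB.instance Definition _ (R S T : comNzRingType)
    (epsR : {rmorphism R -> T}) (epsS : {rmorphism S -> T}) :=
  [isSub for @fiber_val R S T epsR epsS].
HB.instance Definition _ (R S T : comNzRingType)
    (epsR : {rmorphism R -> T}) (epsS : {rmorphism S -> T}) :=
  [Choice of fiber_product epsR epsS by <:].
HB.instance Definition _ (R S T : comNzRingType)
    (epsR : {rmorphism R -> T}) (epsS : {rmorphism S -> T}) :=
  GRing.SubChoice_isSubComNzRing.Build (R * S)%type (fiber_pred epsR epsS)
    (fiber_product epsR epsS) (fiber_subring_closed epsR epsS).

(* [mR x_T mS]: the condition [epsR x.1 = epsS x.2] is part of the type. *)
Definition fiber_ideal (R S T : comNzRingType)
    (epsR : {rmorphism R -> T}) (epsS : {rmorphism S -> T})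
    (mR : set R) (mS : set S) : set (fiber_product epsR epsS) :=
  [set x | mR (fiber_val x).1 /\ mS (fiber_val x).2].

(* Main.v *)
Require Import Defs.
From HB Require Import structures.
From mathcomp Require Import all_boot all_order all_algebra.
From mathcomp Require Import zify ring lra generic_quotient.
From mathcomp Require Import all_classical all_reals all_analysis.
Import Order.TTheory GRing.Theory Num.Theory.
Import numFieldNormedType.Exports.
Local Open Scope classical_set_scope.
Local Open Scope ring_scope.

Set Implicit Arguments.
Unset Strict Implicit.
Unset Printing Implicit Defensive.

(* Write q = p^e, d = dim R, and let A be the fiber product.  Since A maps onto
   R, lengths over A of quotients by m^n + m^[q] are at least the lengths over
   R of the corresponding quotients; and dim A = d, because a prime of A
   contains one of the two kernels, whose product is zero.  So everything
   reduces to a lower bound over the Cohen-Macaulay ring R.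

   Replacing R by R(t), which does not change these lengths, we may assume that
   the residue field is infinite, so that m has a reduction J generated by a
   system of parameters y_1, ..., y_d; let m^(n+c) be contained in J^n for all
   n.  It is obtained from a maximal regular sequence by successive general
   linear changes x_i - c_i z, and it remains regular: if x_1, ..., x_d is
   regular and some power of x_d lies in (x_1, ..., x_(d-1), w), then w is
   regular modulo the other elements.  Let e be the length of R/J.

   On the one hand, if R/J has a filtration with factors generated by a_1, ...,
   a_e and killed by m, then the a_i^q generate a filtration of
   R/(m^(n+c) + J^[q]) whose factors are killed by m^(n+c) + m^[q], so
     l(R/(m^(n+c) + J^[q])) <= e * l(R/(m^(n+c) + m^[q])).
   On the other hand, R/J^[q] has length e * q^d, and its submodule generated by
   J^n has a filtration by monomials y^a with |a| >= n and a in [0, q)^d, each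
   contributing at most e.  Dividing by e,
     l(R/(m^(n+c) + m^[q])) >= #{a in [0, q)^d : |a| < n},
   and for n = ceil(s q) - c the right-hand side is asymptotic to H_s(d) q^d by
   inclusion-exclusion. *)

(** * Ideals and lengths *)


Section Ideals.
Variable R : comNzRingType.
Implicit Types (I J K L O : set R) (a b r u x y : R) (s : seq R) (n : nat).

Lemma idealP I :
  ideal I <-> [/\ I 0, forall x y, I x -> I y -> I (x + y)
                & forall a x, I x -> I (a * x)].
Proof.
split=> [[I0 ID]|[I0 ID IM]].
- move: I0; rewrite inE => I0; split=> // [x y Ix Iy|a x Ix].
  + have := ID 1 x y; rewrite !inE => /(_ Ix Iy); by rewrite scale1r.
  + have := ID a x 0; rewrite !inE => /(_ Ix I0); by rewrite addr0.
- split; first by rewrite inE.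
  by move=> a x y; rewrite !inE => Ix Iy; apply: ID => //; apply: IM.
Qed.

Lemma ideal0 I : ideal I -> I 0. Proof. by case/idealP. Qed.
Lemma idealD I x y : ideal I -> I x -> I y -> I (x + y).
Proof. by case/idealP => _ + _; apply. Qed.
Lemma ideal_mulr I a x : ideal I -> I x -> I (a * x).
Proof. by case/idealP => _ _; apply. Qed.
Lemma ideal_mull I a x : ideal I -> I x -> I (x * a).
Proof. by rewrite mulrC; apply: ideal_mulr. Qed.
Lemma idealN I x : ideal I -> I x -> I (- x).
Proof. by move=> idI Ix; rewrite -mulN1r; apply: ideal_mulr. Qed.
Lemma idealB I x y : ideal I -> I x -> I y -> I (x - y).
Proof. by move=> idI Ix Iy; apply: idealD => //; apply: idealN. Qed.
Lemma ideal_sum I (A : Type) (r : seq A) (P : pred A) (F : A -> R) :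
  ideal I -> (forall i, P i -> I (F i)) -> I (\sum_(i <- r | P i) F i).
Proof.
move=> idI IF; apply: big_ind => //; first exact: ideal0.
by move=> x y; apply: idealD.
Qed.
Lemma ideal_seqsum I (A : eqType) (r : seq A) (F : A -> R) :
  ideal I -> (forall i, i \in r -> I (F i)) -> I (\sum_(i <- r) F i).
Proof. by move=> idI IF; rewrite big_seq; apply: ideal_sum. Qed.
Lemma idealT : ideal [set: R]. Proof. exact/idealP. Qed.
Lemma ideal1 I : ideal I -> I 1 -> I = [set: R].
Proof.
by move=> idI I1; apply/seteqP; split=> // x _; rewrite -[x]mulr1; apply: ideal_mulr.
Qed.
Lemma ideal_zero : ideal [set (0 : R)].
Proof.
by apply/idealP; split=> [//|x y -> ->|a x ->]; rewrite /= ?addr0 ?mulr0.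
Qed.

Lemma ideal_colon I x : ideal I -> ideal [set u | I (u * x)].
Proof.
move=> idI; apply/idealP; split=> /= [|u v Iu Iv|a u Iu].
- by rewrite mul0r; apply: ideal0.
- by rewrite mulrDl; apply: idealD.
- by rewrite -mulrA; apply: ideal_mulr.
Qed.

(** For an ideal [I] this is [I + (a)], with an explicit coefficient, so that one can compute modulo
    [I] without forming a quotient ring. *)
Definition adjoin I a : set R := [set x | exists r, I (x - r * a)].

Lemma ideal_adjoin I a : ideal I -> ideal (adjoin I a).
Proof.
move=> idI; apply/idealP; split.
- by exists 0; rewrite mul0r subr0; apply: ideal0.
- move=> x y [r Ir] [t It]; exists (r + t).
  by rewrite mulrDl opprD addrACA; apply: idealD.
- move=> b x [r Ir]; exists (b * r).
  by rewrite -mulrA -mulrBr; apply: ideal_mulr.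
Qed.

Lemma sub_adjoin I a : I `<=` adjoin I a.
Proof. by move=> x Ix; exists 0; rewrite mul0r subr0. Qed.

Lemma mem_adjoin I a r : ideal I -> adjoin I a (r * a).
Proof. by move=> idI; exists r; rewrite subrr; apply: ideal0. Qed.

Lemma mem_adjoin1 I a : ideal I -> adjoin I a a.
Proof. by move=> idI; rewrite -{2}[a]mul1r; apply: mem_adjoin. Qed.

Lemma adjoin_sub I K a : ideal K -> I `<=` K -> K a -> adjoin I a `<=` K.
Proof.
move=> idK IK Ka x [r Ir]; rewrite -(subrK (r * a) x).
by apply: idealD => //; [apply: IK|apply: ideal_mulr].
Qed.

Lemma adjoinS I K a : I `<=` K -> adjoin I a `<=` adjoin K a.
Proof. by move=> IK x [r Ir]; exists r; apply: IK. Qed.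

Lemma adjoin_id I a : ideal I -> I a -> adjoin I a = I.
Proof.
by move=> idI Ia; apply/seteqP; split; [apply: adjoin_sub|apply: sub_adjoin].
Qed.

Lemma adjoinC I a b : adjoin (adjoin I a) b = adjoin (adjoin I b) a.
Proof.
have H u v : adjoin (adjoin I u) v `<=` adjoin (adjoin I v) u.
  by move=> x [r [t Ix]]; exists t; exists r; rewrite addrAC.
by apply/seteqP; split.
Qed.

(** The base ideal [I] is a parameter, so that [gen I s] plays the role of the ideal generated by
    [s] in [R/I]. *)
Definition gen I s : set R := foldr (fun a J => adjoin J a) I s.

Lemma ideal_gen I s : ideal I -> ideal (gen I s).
Proof. by move=> idI; elim: s => //= a s; apply: ideal_adjoin. Qed.

Lemma sub_gen I s : I `<=` gen I s.
Proof. by elim: s => //= a s IHs x /IHs; apply: sub_adjoin. Qed.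

Lemma gen_cat I s1 s2 : gen I (s1 ++ s2) = gen (gen I s2) s1.
Proof. exact: foldr_cat. Qed.

Lemma mem_gen I s a : ideal I -> a \in s -> gen I s a.
Proof.
move=> idI; elim: s => //= b s IHs; rewrite inE => /predU1P[->|/IHs].
- by apply: mem_adjoin1; apply: ideal_gen.
- exact: sub_adjoin.
Qed.

Lemma gen_sub I K s : ideal K -> I `<=` K -> (forall a, a \in s -> K a) ->
  gen I s `<=` K.
Proof.
move=> idK IK; elim: s => //= a s IHs Ks; apply: adjoin_sub => //.
- by apply: IHs => b bs; apply: Ks; rewrite inE bs orbT.
- by apply: Ks; rewrite inE eqxx.
Qed.

Lemma gen_adjoin I a s : gen (adjoin I a) s = adjoin (gen I s) a.
Proof. by elim: s => //= b s ->; rewrite adjoinC. Qed.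

Lemma genS I K s : I `<=` K -> gen I s `<=` gen K s.
Proof. by move=> IK; elim: s => //= a s IHs; apply: adjoinS. Qed.

Lemma gen_subseq I s1 s2 : ideal I -> {subset s1 <= s2} -> gen I s1 `<=` gen I s2.
Proof.
move=> idI s12; apply: gen_sub (ideal_gen s2 idI) (sub_gen s2) _.
by move=> a /s12; apply: mem_gen.
Qed.

Lemma eq_gen I s1 s2 : ideal I -> s1 =i s2 -> gen I s1 = gen I s2.
Proof.
by move=> idI E; apply/seteqP; split; apply: gen_subseq => // a; rewrite E.
Qed.

Lemma perm_gen I s1 s2 : ideal I -> perm_eq s1 s2 -> gen I s1 = gen I s2.
Proof. by move=> idI /perm_mem; apply: eq_gen. Qed.

Lemma gen_span s : ideal_span [set` s] = gen [set 0] s.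
Proof.
apply/seteqP; split=> x.
- apply; split; first by apply: ideal_gen; apply: ideal_zero.
  by move=> a; apply: mem_gen; apply: ideal_zero.
- move=> gx I [idI sI]; move: x gx; apply: gen_sub => //.
  by move=> x ->; apply: ideal0.
Qed.

Lemma ideal_span_ideal (X : set R) : ideal (ideal_span X).
Proof.
apply/idealP; split.
- by move=> I [idI _]; apply: ideal0.
- by move=> x y Hx Hy I HI; apply: idealD; [case: HI|apply: Hx|apply: Hy].
- by move=> a x Hx I HI; apply: ideal_mulr; [case: HI|apply: Hx].
Qed.

Lemma sub_ideal_span (X : set R) : X `<=` ideal_span X.
Proof. by move=> x Xx I [_]; apply. Qed.

Lemma ideal_span_sub (X : set R) K : ideal K -> X `<=` K -> ideal_span X `<=` K.
Proof. by move=> idK XK x; apply. Qed.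

End Ideals.

(** * Upper and lower bounds for lengths *)

Section Length.
Variables (R : comNzRingType) (m : set R).
Implicit Types (I J K L : set R) (a b r u x y : R) (s : seq R) (n : nat).

(* [len_le m K I n] says that (K + I)/I has length at most [n], as witnessed by
   a filtration with cyclic factors killed by [m]. *)
Inductive len_le (K : set R) : set R -> nat -> Prop :=
| len_le_nil I n : K `<=` I -> len_le K I n
| len_le_cons I a n : (forall u, m u -> I (u * a)) ->
    len_le K (adjoin I a) n -> len_le K I n.+1.

(* [len_ge K I n] says that K/I has length at least [n]. *)
Inductive len_ge (K : set R) : set R -> nat -> Prop :=
| len_ge_nil I : len_ge K I 0
| len_ge_cons I J n : ideal J -> J `<=` K -> I `<=` J -> ~ (J `<=` I) ->
    len_ge K J n -> len_ge K I n.+1.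

Lemma len_le_leq K I n n' : (n <= n')%N -> len_le K I n -> len_le K I n'.
Proof.
move=> nn' H; elim: H n' nn' => {I n} [I n KI|I a n ma _ IH] n' nn'.
- exact: len_le_nil.
- case: n' nn' => // n' nn'; apply: len_le_cons (IH _ _) => //.
Qed.

Lemma len_leS K I I' n : I `<=` I' -> len_le K I n -> len_le K I' n.
Proof.
move=> II' H; elim: H I' II' => {I n} [I n KI|I a n ma _ IH] I' II'.
- by apply: len_le_nil; apply: subset_trans II'.
- apply: (@len_le_cons _ _ a); first by move=> u mu; apply: II'; apply: ma.
  by apply: IH; apply: adjoinS.
Qed.

Lemma len_le_sub K K' I n : K' `<=` K -> len_le K I n -> len_le K' I n.
Proof.
move=> KK'; elim=> {I n} [I n KI|I a n ma _ IH].
- by apply: len_le_nil; apply: subset_trans KI.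
- exact: len_le_cons IH.
Qed.

Lemma len_le_trans K L I n1 n2 : len_le K I n1 -> len_le L K n2 ->
  len_le L I (n1 + n2).
Proof.
elim=> {I n1} [I n KI|I a n ma _ IH] H.
- by apply: len_le_leq (leq_addl _ _) _; apply: len_leS H.
- by rewrite addSn; apply: len_le_cons (IH H).
Qed.

(** Multiplication by [x] carries a filtration of [K/I] to one of [K'/I']. The condition on all [L]
    says that [K'] lies in [I' + xK], so that the image exhausts [K']. *)
Lemma len_le_scale x I I' K K' n : (forall u, I u -> I' (u * x)) ->
  ideal I' ->
  (forall L, ideal L -> I' `<=` L -> (forall u, K u -> L (u * x)) -> K' `<=` L) ->
  len_le K I n -> len_le K' I' n.
Proof.
move=> + + + H; elim: H I' => {I n} [I n KI|I a n ma _ IH] I' II' idI' HK'.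
- by apply: len_le_nil; apply: HK' => // u /KI /II'.
- apply: (@len_le_cons _ _ (a * x)).
    by move=> u mu; rewrite mulrA; apply/II'/ma.
  apply: IH; last first.
  + by move=> L idL sL HL; apply: HK' => //; apply: subset_trans sL; apply: sub_adjoin.
  + exact: ideal_adjoin.
  + by move=> u [r Ir]; exists r; rewrite mulrA -mulrBl; apply: II'.
Qed.

Lemma len_ge_sub K K' I n : K `<=` K' -> len_ge K I n -> len_ge K' I n.
Proof.
move=> KK'; elim=> {I n} [I|I J n idJ JK IJ nJI _ IH]; first exact: len_ge_nil.
by apply: len_ge_cons IH => //; apply: subset_trans KK'.
Qed.

Lemma len_geS K I I' n : I `<=` I' -> len_ge K I' n -> len_ge K I n.
Proof.
move=> + H; case: I' n / H => [J _|J L k idL LK JL nLJ H IJ].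
  exact: len_ge_nil.
apply: (len_ge_cons idL LK _ _ H); first exact: subset_trans JL.
by move=> LI; apply: nLJ => x /LI /IJ.
Qed.

Lemma len_ge_geq K I n n' : (n' <= n)%N -> len_ge K I n -> len_ge K I n'.
Proof.
move=> + H; elim: H n' => {I n} [I|I J n idJ JK IJ nJI _ IH] [|n'] //= nn'.
- exact: len_ge_nil.
- exact: len_ge_nil.
- exact: (len_ge_cons idJ JK IJ nJI (IH _ _)).
Qed.

Lemma len_ge_trans K L I n1 n2 : ideal K -> I `<=` K -> K `<=` L ->
  len_ge K I n1 -> len_ge L K n2 -> len_ge L I (n1 + n2).
Proof.
move=> idK + KL H1 H2; elim: H1 => {I n1} [I|I J n idJ JK IJ nJI _ IH] IK.
- exact: len_geS H2.
- rewrite addSn; apply: (len_ge_cons idJ) (IH JK) => //.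
  exact: subset_trans KL.
Qed.

(** Replacing each ideal [J] of a chain above [I] by [I' + xJ] keeps the inclusions strict, because
    [u * x] lies in [I'] only for [u] in [I]. *)
Lemma len_ge_scale x I I' K K' n :
  (forall u, I' (u * x) -> I u) -> ideal I' ->
  (forall u, K u -> K' (u * x)) -> I' `<=` K' -> ideal K' ->
  len_ge K I n -> len_ge K' I' n.
Proof.
move=> + + HK + idK'; move=> + + + H.
elim: H I' => {I n} [I|I J n idJ JK IJ nJI _ IH] I' HI idI' IK'.
  exact: len_ge_nil.
pose J' := [set v | exists2 u, J u & I' (v - u * x)].
have sJ : I' `<=` J'.
  by move=> v Iv; exists 0; rewrite ?mul0r ?subr0 //; apply: ideal0.
have idJ' : ideal J'.
  apply/idealP; split; first by apply: sJ; apply: ideal0.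
  - move=> v w [u Ju Iu] [t Jt It]; exists (u + t); first exact: idealD.
    by rewrite mulrDl opprD addrACA; apply: idealD.
  - move=> a v [u Ju Iu]; exists (a * u); first exact: ideal_mulr.
    by rewrite -mulrA -mulrBr; apply: ideal_mulr.
have J'K' : J' `<=` K'.
  move=> v [u Ju Iu]; rewrite -(subrK (u * x) v); apply: idealD => //.
    exact: IK'.
  by apply: HK; apply: JK.
apply: (@len_ge_cons _ _ J') => //.
- move=> J'I'; apply: nJI => u Ju; apply: HI; apply: J'I'; exists u => //.
  by rewrite subrr; apply: ideal0.
- apply: IH => // v [u Ju Iv]; rewrite -(subrK u v); apply: idealD => //.
  by apply: IJ; apply: HI; rewrite mulrBl.
Qed.

(** Dropping every generator that already lies in the ideal turns the filtration into a strict chain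
    with the same number of steps. *)
Lemma len_exact I n : ideal I -> len_le [set: R] I n ->
  exists e, len_le [set: R] I e /\ len_ge [set: R] I e.
Proof.
move=> + H; elim: H => {I n} [I n KI|I a n ma _ IH] idI.
  by exists 0%N; split; [exact: len_le_nil|exact: len_ge_nil].
have [e [H1 H2]] := IH (ideal_adjoin a idI).
have [Ia|nIa] := pselect (I a).
  by exists e; rewrite -{1 2}(adjoin_id idI Ia).
exists e.+1; split; first exact: len_le_cons H1.
apply: (len_ge_cons (ideal_adjoin a idI)) H2 => //; first exact: sub_adjoin.
by move=> /(_ a (mem_adjoin1 a idI)).
Qed.

(** Multiplication by [x] maps [R/(O, x^n)] onto [(O, x)/(O, x^(n+1))], so each further power of [x]
    costs at most [e]. *)
Lemma len_le_pow O x e n : ideal O -> len_le [set: R] (adjoin O x) e ->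
  len_le [set: R] (adjoin O (x ^+ n)) (n * e).
Proof.
move=> idO H; elim: n => [|n IHn].
  apply: len_le_nil => y _; exists y; rewrite expr0 mulr1 subrr; exact: ideal0.
rewrite mulSn.
have H2 : len_le (adjoin O x) (adjoin O (x ^+ n.+1)) (n * e).
  apply: (len_le_scale (x := x)) IHn.
  - move=> u [r Ou]; exists r; rewrite exprSr mulrA -mulrBl; exact: ideal_mull.
  - exact: ideal_adjoin.
  - move=> L idL OL HL v [r Or]; rewrite -(subrK (r * x) v).
    apply: idealD => //; last exact: HL.
    by apply: OL; apply: sub_adjoin.
by rewrite addnC; apply: len_le_trans H2 H.
Qed.

(** Adjoining all generators of [m] leaves length at most one. They are removed again one by one
    with [len_le_pow], as [O + (a^n) = O] for some [n]. *)
Lemma len_le_ex O s : ideal O ->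
  m `<=` gen O s -> (forall a, a \in s -> exists n, O (a ^+ n)) ->
  exists e, len_le [set: R] O e.
Proof.
elim: s O => [|a s IH] O idO /= mO nilO.
  exists 1%N; apply: (@len_le_cons _ _ 1) => [u mu|]; first by rewrite mulr1; apply: mO.
  apply: len_le_nil => u _; exists u; rewrite mulr1 subrr; exact: ideal0.
have [e He] : exists e, len_le [set: R] (adjoin O a) e.
  apply: IH (ideal_adjoin a idO) _ _; first by rewrite gen_adjoin.
  move=> b bs; have [|n On] := nilO b; first by rewrite inE bs orbT.
  by exists n; apply: sub_adjoin.
have [|n On] := nilO a; first by rewrite inE eqxx.
by exists (n * e)%N; rewrite -(adjoin_id idO On); apply: len_le_pow.
Qed.

Hypothesis (munit : forall a, ~ m a -> exists b, b * a = 1).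

(** Let [J] be the first step of the chain. If [a] is in [J], the tail already lies above [I + (a)].
    Otherwise [J + (a)] is strictly larger than [I + (a)]: if [v] in [J] is [r * a] modulo [I], a
    unit [r] would put [a] in [J], so [r] is in [m] and [v] in [I]. *)
Lemma len_ge_adjoin I a M : ideal I -> (forall u, m u -> I (u * a)) ->
  len_ge [set: R] I M.+1 -> len_ge [set: R] (adjoin I a) M.
Proof.
elim: M I => [|M IH] I idI ma H; first exact: len_ge_nil.
inversion H as [|I0 J k idJ _ IJ nJI H' E1 E2]; subst.
have [Ja|nJa] := pselect (J a).
  apply: len_geS H'; exact: adjoin_sub.
have maJ u : m u -> J (u * a) by move=> mu; apply: IJ; apply: ma.
apply: (len_ge_cons (ideal_adjoin a idJ)) (IH _ idJ maJ H') => //.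
  exact: adjoinS.
move=> JI; apply: nJI => v Jv.
have [r Ir] := JI _ (sub_adjoin a Jv).
have [mr|nmr] := pselect (m r).
  by rewrite -(subrK (r * a) v); apply: idealD => //; apply: ma.
have [b br] := munit nmr; case: nJa.
rewrite -[a]mul1r -br -mulrA; apply: ideal_mulr => //.
have -> : r * a = v - (v - r * a) by rewrite opprB addrC subrK.
by apply: idealB => //; apply: IJ.
Qed.

(** The Jordan-Hoelder comparison: each step of the upper filtration shortens a chain by at most
    one. *)
Theorem len_le_ge I n M : ideal I -> len_le [set: R] I n ->
  len_ge [set: R] I M -> (M <= n)%N.
Proof.
move=> + H; elim: H M => {I n} [I n KI|I a n ma _ IH] M idI H.
  inversion H as [|I0 J k idJ _ IJ nJI H' E1 E2]; subst => //.
  by case: nJI => x Jx; apply: KI.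
case: M H => // M H; apply: IH; first exact: ideal_adjoin.
exact: len_ge_adjoin.
Qed.

End Length.

(** * Powers of ideals and reductions *)

Section Powers.
Variable R : comNzRingType.
Implicit Types (I J K L O T : set R) (a b r u x y : R) (s : seq R) (n : nat).

Lemma ideal_ideal_mul I J : ideal (ideal_mul I J).
Proof. exact: ideal_span_ideal. Qed.

Lemma mem_ideal_mul I J a b : I a -> J b -> ideal_mul I J (a * b).
Proof. by move=> Ia Jb; apply: sub_ideal_span; exists a => //; exists b. Qed.

Lemma ideal_mul_sub I J K : ideal K ->
  (forall a b, I a -> J b -> K (a * b)) -> ideal_mul I J `<=` K.
Proof.
move=> idK H; apply: ideal_span_sub => // _ [a Ia [b Jb <-]]; exact: H.
Qed.

Lemma ideal_ideal_pow I n : ideal (ideal_pow I n).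
Proof. case: n => [|n]; [exact: idealT|exact: ideal_ideal_mul]. Qed.

Lemma mem_ideal_powS I n a b : I a -> ideal_pow I n b ->
  ideal_pow I n.+1 (a * b).
Proof. exact: mem_ideal_mul. Qed.

Lemma ideal_powS_sub I n K : ideal K ->
  (forall a b, I a -> ideal_pow I n b -> K (a * b)) -> ideal_pow I n.+1 `<=` K.
Proof. exact: ideal_mul_sub. Qed.

Lemma ideal_powD I i j a b : ideal_pow I i a -> ideal_pow I j b ->
  ideal_pow I (i + j) (a * b).
Proof.
move=> Ia Ib; move: a Ia; elim: i => [|i IHi] a Ia.
  by rewrite add0n; apply: ideal_mulr => //; apply: ideal_ideal_pow.
suff: ideal_pow I i.+1 `<=` [set u | ideal_pow I (i.+1 + j) (u * b)] by apply.
apply: ideal_powS_sub; first exact/ideal_colon/ideal_ideal_pow.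
by move=> c e Ic Ie /=; rewrite -mulrA; apply: mem_ideal_powS => //; apply: IHi.
Qed.

Lemma ideal_pow_leq I i j : (i <= j)%N -> ideal_pow I j `<=` ideal_pow I i.
Proof.
move=> ij; rewrite -(subnK ij); elim: (j - i)%N => [|k IHk] //.
rewrite addSn; apply: subset_trans IHk; apply: ideal_powS_sub.
  exact: ideal_ideal_pow.
by move=> a b _ Ib; apply: ideal_mulr => //; apply: ideal_ideal_pow.
Qed.

Lemma ideal_powS I K n : I `<=` K -> ideal_pow I n `<=` ideal_pow K n.
Proof.
move=> IK; elim: n => // n IHn; apply: ideal_powS_sub.
  exact: ideal_ideal_pow.
by move=> a b /IK Ka /IHn; apply: mem_ideal_powS.
Qed.

Lemma mem_ideal_pow I n a : I a -> ideal_pow I n (a ^+ n).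
Proof.
by move=> Ia; elim: n => // n IHn; rewrite exprS; apply: mem_ideal_powS.
Qed.

Lemma ideal_pow1 I : ideal I -> ideal_pow I 1 = I.
Proof.
move=> idI; apply/seteqP; split.
  by apply: ideal_powS_sub => // a b Ia _; apply: ideal_mull.
by move=> a Ia; rewrite -[a]expr1; apply: mem_ideal_pow.
Qed.

Lemma ideal_ideal_add I J : ideal I -> ideal J -> ideal (ideal_add I J).
Proof.
move=> idI idJ; apply/idealP; split.
- by exists 0; [exact: ideal0|exists 0; [exact: ideal0|rewrite addr0]].
- move=> _ _ [a Ia [b Jb <-]] [c Ic [e Je <-]].
  by exists (a + c); [exact: idealD|exists (b + e); [exact: idealD|rewrite addrACA]].
- move=> r _ [a Ia [b Jb <-]].
  by exists (r * a); [exact: ideal_mulr|exists (r * b); [exact: ideal_mulr|rewrite mulrDr]].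
Qed.

Lemma sub_ideal_addl I J : ideal J -> I `<=` ideal_add I J.
Proof.
by move=> idJ x Ix; exists x => //; exists 0; [exact: ideal0|rewrite addr0].
Qed.

Lemma sub_ideal_addr I J : ideal I -> J `<=` ideal_add I J.
Proof.
by move=> idJ x Ix; exists 0; [exact: ideal0|exists x; rewrite // add0r].
Qed.

Lemma ideal_add_sub I J K : ideal K -> I `<=` K -> J `<=` K ->
  ideal_add I J `<=` K.
Proof. by move=> idK IK JK _ [a /IK Ka [b /JK Kb <-]]; apply: idealD. Qed.

(** The target [T] is arbitrary because the induction replaces it by its colon ideals with respect
    to elements of [I] and [J]. *)
Lemma ideal_pow_add I J n T : ideal T ->
  (forall i j a b, (i + j = n)%N -> ideal_pow I i a -> ideal_pow J j b -> T (a * b)) ->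
  ideal_pow (ideal_add I J) n `<=` T.
Proof.
elim: n T => [|n IHn] T idT HT.
  move=> x _; rewrite -[x]mulr1; apply: ideal_mulr => //.
  by rewrite -[1]mulr1; apply: (HT 0%N 0%N).
apply: ideal_powS_sub => // _ b [c Ic [e Je <-]] Hb; rewrite mulrDl.
have colon z : ideal [set u | T (z * u)].
  by have -> : [set u | T (z * u)] = [set u | T (u * z)];
    [apply/seteqP; split=> u /=; rewrite mulrC|apply: ideal_colon].
apply: idealD => //.
- suff: ideal_pow (ideal_add I J) n `<=` [set u | T (c * u)] by apply.
  apply: IHn => // i j a u ij Ia Ju /=; rewrite mulrA.
  by apply: (HT i.+1 j) => //; [rewrite addSn ij|apply: mem_ideal_powS].
- suff: ideal_pow (ideal_add I J) n `<=` [set u | T (e * u)] by apply.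
  apply: IHn => // i j a u ij Ia Ju /=; rewrite mulrCA.
  by apply: (HT i j.+1) => //; [rewrite addnS ij|apply: mem_ideal_powS].
Qed.

(* Up to a bounded shift, [I] and [K] have the same powers; this holds when
   [K] is a reduction of [I]. *)
Definition pow_equiv I K : Prop :=
  exists c, forall n, ideal_pow I (n + c) `<=` ideal_pow K n.

Lemma pow_equiv_trans I K L : pow_equiv I K -> pow_equiv K L -> pow_equiv I L.
Proof.
move=> [c Hc] [e He]; exists (e + c)%N => n; rewrite addnA.
exact: subset_trans (Hc _) (He _).
Qed.

Lemma pow_equiv_sub I K : I `<=` K -> pow_equiv I K.
Proof. by move=> IK; exists 0%N => n; rewrite addn0; apply: ideal_powS. Qed.

Lemma pow_equiv_add I K L : ideal I -> ideal K -> ideal L -> pow_equiv I K ->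
  pow_equiv (ideal_add I L) (ideal_add K L).
Proof.
move=> idI idK idL [c Hc]; exists c => n; apply: ideal_pow_add => [|i j a b ij Ia Lb].
  exact: ideal_ideal_pow.
have Lb' : ideal_pow (ideal_add K L) j b.
  by apply: ideal_powS Lb; apply: sub_ideal_addr.
have [ci|ic] := leqP c i.
  have Ka : ideal_pow (ideal_add K L) (i - c) a.
    apply: (@ideal_powS K); first exact: sub_ideal_addl.
    by apply: Hc; rewrite subnK.
  apply: (@ideal_pow_leq _ n (i - c + j)); last exact: ideal_powD.
  by lia.
apply: ideal_mulr; first exact: ideal_ideal_pow.
apply: ideal_pow_leq Lb'; lia.
Qed.

(** The inclusion iterates to [I^(N+n)] inside [K^N I^n], so the shift is [n]. *)
Lemma pow_equiv_reduction I K n : ideal K -> K `<=` I ->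
  ideal_pow I n.+1 `<=` ideal_mul K (ideal_pow I n) -> pow_equiv I K.
Proof.
move=> idK KI H; exists n => N.
suff: ideal_pow I (N + n) `<=` ideal_mul (ideal_pow K N) (ideal_pow I n).
  move/subset_trans; apply; apply: ideal_mul_sub; first exact: ideal_ideal_pow.
  by move=> a b Ka _; apply: ideal_mull => //; apply: ideal_ideal_pow.
elim: N => [|N IHN].
  by move=> x Ix; rewrite -[x]mul1r; apply: mem_ideal_mul.
rewrite addSn; apply: ideal_powS_sub; first exact: ideal_ideal_mul.
move=> a b Ia /IHN.
suff: ideal_mul (ideal_pow K N) (ideal_pow I n) `<=`
  [set u | ideal_mul (ideal_pow K N.+1) (ideal_pow I n) (u * a)].
  by rewrite mulrC => + Hb => /(_ _ Hb).
apply: ideal_mul_sub; first exact/ideal_colon/ideal_ideal_mul.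
move=> u v Ku Iv /=; rewrite -mulrA [v * a]mulrC.
have /H : ideal_pow I n.+1 (a * v) by apply: mem_ideal_powS.
suff: ideal_mul K (ideal_pow I n) `<=`
  [set w | ideal_mul (ideal_pow K N.+1) (ideal_pow I n) (w * u)].
  by rewrite [u * _]mulrC => + Hb => /(_ _ Hb).
apply: ideal_mul_sub; first exact/ideal_colon/ideal_ideal_mul.
move=> w t Kw It /=; rewrite mulrAC; apply: mem_ideal_mul => //.
exact: mem_ideal_powS.
Qed.

(** The last power of [m] not contained in [I] supplies a socle element of [R/I]. *)
Lemma pow_nonsub (m I : set R) n : ideal_pow m n `<=` I -> ideal I -> ~ I 1 ->
  exists a, ~ I a /\ forall u, m u -> I (u * a).
Proof.
move=> + idI nI1; elim: n => [|n IHn] mI; first by case: nI1; apply: mI.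
have [/IHn//|/existsNP[a /not_implyP[ma nIa]]] := pselect (ideal_pow m n `<=` I).
by exists a; split=> // u mu; apply: mI; apply: mem_ideal_powS.
Qed.

(** While [1] is not in [I], a socle element can be adjoined, which makes a strict step; the bound
    on chains stops this after at most [L] steps. *)
Lemma len_le_bounded (m I : set R) n (L : nat) : ideal I ->
  ideal_pow m n `<=` I ->
  (forall M, len_ge [set: R] I M -> (M <= L)%N) -> len_le m [set: R] I L.
Proof.
elim: L I => [|L IH] I idI mI H.
  have [I1|nI1] := pselect (I 1).
    by apply: len_le_nil; rewrite (ideal1 idI I1).
  have H1 : len_ge [set: R] I 1.
    apply: (len_ge_cons (@idealT R)) (len_ge_nil _ _) => //.
    by move=> TI; apply: nI1; apply: TI.
  by have := H _ H1.
have [I1|nI1] := pselect (I 1).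
  by apply: len_le_nil; rewrite (ideal1 idI I1).
have [a [nIa ma]] := pow_nonsub mI idI nI1.
apply: (len_le_cons ma); apply: IH (ideal_adjoin a idI) _ _.
  by apply: subset_trans mI _; apply: sub_adjoin.
move=> M HM; rewrite -ltnS; apply: H.
apply: (len_ge_cons (ideal_adjoin a idI)) HM => //; first exact: sub_adjoin.
by move=> /(_ a (mem_adjoin1 a idI)).
Qed.

End Powers.

(** * Quasi-regular sequences *)

Section QuasiRegular.
Variable R : comNzRingType.
Implicit Types (I J K L O : set R) (a b r u w x y : R) (s xs p : seq R).
Implicit Types (l : seq (R * nat)) (n k t M : nat).

Lemma adjoin_exp O w b n : ideal O -> adjoin O w b -> adjoin O (w ^+ n) (b ^+ n).
Proof.
move=> idO [v Ov]; exists (v ^+ n); rewrite -exprMn subrXX; exact: ideal_mull.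
Qed.

Lemma adjoin_exp1 O b : adjoin O (b ^+ 1) = adjoin O b.
Proof. by rewrite expr1. Qed.

Definition nzd O a : Prop := forall r, O (r * a) -> O r.

(** Multiplication by [a] from [R/(O, a^n)] to [R/(O, a^(n+1))] is injective. This weakening of
    [nzd] suffices for counting lengths and is preserved by the exchanges below. *)
Definition qnzd O a : Prop :=
  forall n r, adjoin O (a ^+ n.+1) (r * a) -> adjoin O (a ^+ n) r.

Lemma nzd_exp O a n r : nzd O a -> O (r * a ^+ n) -> O r.
Proof.
move=> H; elim: n r => [|n IH] r; first by rewrite mulr1.
by rewrite exprSr mulrA => /H /IH.
Qed.

Lemma qnzd_exp O a n t r : qnzd O a ->
  adjoin O (a ^+ (n + t)) (r * a ^+ t) -> adjoin O (a ^+ n) r.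
Proof.
move=> H; elim: t r => [|t IH] r; first by rewrite mulr1 addn0.
by rewrite addnS [a ^+ t.+1]exprSr mulrA => /H /IH.
Qed.

Lemma nzd_qnzd O a : nzd O a -> qnzd O a.
Proof.
move=> H n r [s]; rewrite exprSr mulrA -mulrBl => /H Os; by exists s.
Qed.

(** Cancelling [a] modulo [(O, b)] gives [r = s * b] modulo [O]. Then [s * a * b] lies in
    [(O, b^(k+1))], [b] cancels by [qnzd], and the case of exponent [k] applies to [s]. *)
Lemma nzd_adjoin_expS O a b k : ideal O -> qnzd O b -> nzd (adjoin O b) a ->
  nzd (adjoin O (b ^+ k)) a -> nzd (adjoin O (b ^+ k.+1)) a.
Proof.
move=> idO Hb H1 Hk r Hr.
have [s Os] : adjoin O b r.
  apply: H1; apply: adjoin_sub Hr; [exact: ideal_adjoin|exact: sub_adjoin|].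
  by rewrite exprS; apply: ideal_mull (ideal_adjoin _ idO) (mem_adjoin1 _ idO).
have : adjoin O (b ^+ k.+1) (s * a * b).
  have -> : s * a * b = r * a - (r - s * b) * a by ring.
  apply: idealB => //; first exact: ideal_adjoin.
  by apply: sub_adjoin; apply: ideal_mull.
move=> /Hb /Hk [v Ov]; exists v; rewrite exprSr mulrA.
have -> : r - v * b ^+ k * b = (r - s * b) + (s - v * b ^+ k) * b by ring.
by apply: idealD => //; apply: ideal_mull.
Qed.

(** Let [r * b = v * b^(n+1) + s * a^M] modulo [O]. Then [s * a^M] lies in [(O, b)], so [s = s' * b]
    modulo [O], and [b] cancels from the whole relation. *)
Lemma qnzd_adjoin_nzd O a b M : ideal O -> qnzd O b ->
  nzd (adjoin O b) a -> qnzd (adjoin O (a ^+ M)) b.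
Proof.
move=> idO Hb Ha n r [v [s Os]].
have [s' Os'] : adjoin O b s.
  apply: (nzd_exp (n := M) Ha); exists (r - v * b ^+ n).
  have -> : s * a ^+ M - (r - v * b ^+ n) * b =
    - (r * b - v * b ^+ n.+1 - s * a ^+ M) by rewrite exprSr; ring.
  exact: idealN.
have : adjoin O (b ^+ n.+1) ((r - v * b ^+ n - s' * a ^+ M) * b).
  apply: sub_adjoin.
  have -> : (r - v * b ^+ n - s' * a ^+ M) * b =
     (r * b - v * b ^+ n.+1 - s * a ^+ M) + (s - s' * b) * a ^+ M.
    by rewrite exprSr; ring.
  by apply: idealD => //; apply: ideal_mull.
move=> /Hb [v' Ov']; exists (v + v'); exists s'.
have -> : r - (v + v') * b ^+ n - s' * a ^+ M =
  r - v * b ^+ n - s' * a ^+ M - v' * b ^+ n by ring.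
exact: Ov'.
Qed.

(** Modulo [O] a power of [a] is a multiple of [w], so whatever [w] kills is killed by that power,
    which [qnzd_exp] cancels. *)
Lemma qnzd_annihilator O a w t M r : ideal O -> qnzd O a ->
  adjoin O w (a ^+ t) -> O (r * w) -> adjoin O (a ^+ M) r.
Proof.
move=> idO Ha [s Os] Orw; apply: (qnzd_exp (t := t) Ha); apply: sub_adjoin.
have -> : r * a ^+ t = r * (a ^+ t - s * w) + s * (r * w) by ring.
by apply: idealD => //; apply: ideal_mulr.
Qed.

(** If [r * w = s * w^(n+1)] modulo [O], then [r - s * w^n] is killed by [w], hence lies in
    [(O, a^(t * n))], which is inside [(O, w^n)]. *)
Lemma qnzd_exchange O a w t : ideal O -> qnzd O a -> adjoin O w (a ^+ t) ->
  qnzd O w.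
Proof.
move=> idO Ha Hw n r [s]; rewrite exprSr mulrA -mulrBl => Os.
have Hr := qnzd_annihilator (t * n) idO Ha Hw Os.
have : adjoin O (w ^+ n) (r - s * w ^+ n).
  apply: adjoin_sub Hr; [exact: ideal_adjoin|exact: sub_adjoin|].
  by rewrite exprM; apply: adjoin_exp.
by case=> v Ov; exists (s + v); rewrite mulrDl opprD addrA.
Qed.

(** If [r * b = v * b^(n+1) + s * w^M] modulo [O], then [w^M] kills [s] modulo [(O, b)], so [s] lies
    in [(O, b, a^N)] for every [N]. After substitution [b] cancels modulo [(O, a^N)]. *)
Lemma qnzd_exchange_other O a b w M : ideal O ->
  (forall k, qnzd (adjoin O (a ^+ k)) b) ->
  (forall k, qnzd (adjoin O (b ^+ k)) a) ->
  (forall k, exists t, adjoin (adjoin O (b ^+ k)) w (a ^+ t)) ->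
  qnzd (adjoin O (w ^+ M)) b.
Proof.
move=> idO Hb Ha Hw n r [v [s Os]].
have [t Ht] := Hw n; have [t1 Ht1] := Hw 1%N.
have idOb k := ideal_adjoin (b ^+ k) idO.
(* The exponent [t * M] serves the last step: [a^t] in [(O, b^n, w)] gives [a^(t * M)] in
   [(O, b^n, w^M)]. *)
have : adjoin (adjoin O (b ^+ 1)) (a ^+ (t * M)) s.
  apply: (qnzd_annihilator (w := w ^+ M) (t := (t1 * M)%N)) => //.
    by rewrite exprM; apply: adjoin_exp.
  exists (r - v * b ^+ n).
  have -> : s * w ^+ M - (r - v * b ^+ n) * b ^+ 1 =
    - (r * b - v * b ^+ n.+1 - s * w ^+ M) by rewrite [b ^+ n.+1]exprSr expr1; ring.
  exact: idealN.
case=> s'' [s' Os'].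
have : adjoin (adjoin O (a ^+ (t * M))) (b ^+ n.+1)
         ((r - v * b ^+ n - s' * w ^+ M) * b).
  apply: sub_adjoin; exists (s'' * w ^+ M).
  have -> : (r - v * b ^+ n - s' * w ^+ M) * b - s'' * w ^+ M * a ^+ (t * M) =
     (r * b - v * b ^+ n.+1 - s * w ^+ M)
     + (s - s'' * a ^+ (t * M) - s' * b ^+ 1) * w ^+ M.
    by rewrite [b ^+ n.+1]exprSr expr1; ring.
  by apply: idealD => //; apply: ideal_mull.
move=> /Hb; rewrite adjoinC => H.
have : adjoin (adjoin O (w ^+ M)) (b ^+ n) (r - v * b ^+ n - s' * w ^+ M).
  rewrite adjoinC; apply: adjoin_sub H.
  - exact/ideal_adjoin/idOb.
  - exact: sub_adjoin.
  - by rewrite exprM; apply: adjoin_exp.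
case=> v' [s3 Os3]; exists (v + v'), (s3 + s').
have -> : r - (v + v') * b ^+ n - (s3 + s') * w ^+ M =
  r - v * b ^+ n - s' * w ^+ M - v' * b ^+ n - s3 * w ^+ M by ring.
exact: Os3.
Qed.

Definition powers l : seq R := [seq z.1 ^+ z.2 | z <- l].

Lemma powers_nil O l b : ideal O -> gen O (unzip1 l) b ->
  exists t, gen O (powers l) (b ^+ t).
Proof.
elim: l O b => [|[x n] l IH] O b idO /=; first by exists 1%N.
rewrite -gen_adjoin => /(IH _ _ (ideal_adjoin x idO)) [t].
rewrite gen_adjoin => H; exists (t * n)%N; rewrite exprM.
by apply: adjoin_exp => //; apply: ideal_gen.
Qed.

(* A permutation-invariant form of regularity: [a] can be cancelled modulo
   any ideal generated by powers of the members of the sequence. *)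
Definition quasi_regular xs : Prop :=
  forall a l, perm_eq (a :: unzip1 l) xs -> qnzd (gen [set 0] (powers l)) a.

Let id0 := @ideal_zero R.

Lemma quasi_regular_perm xs ys : perm_eq xs ys -> quasi_regular xs ->
  quasi_regular ys.
Proof.
by move=> xy H a l al; apply: H; apply: perm_trans al _; rewrite perm_sym.
Qed.

Lemma perm_gen_powers O l l' : ideal O -> perm_eq l l' ->
  gen O (powers l) = gen O (powers l').
Proof. by move=> idO ll'; apply: perm_gen => //; apply: perm_map. Qed.

Lemma perm_swap a b s : perm_eq [:: a, b & s] [:: b, a & s].
Proof. by rewrite -[[:: a, b & s]]/([:: a] ++ [:: b] ++ s) perm_catCA. Qed.

Lemma perm_unzip_cons (b w : R) l p : b != w -> perm_eq (b :: unzip1 l) (w :: p) ->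
  exists M l', [/\ perm_eq l ((w, M) :: l') & perm_eq (b :: unzip1 l') p].
Proof.
move=> bw H.
have : w \in b :: unzip1 l by rewrite (perm_mem H) inE eqxx.
rewrite inE eq_sym (negPf bw) /= => /mapP [[w' M] wl /= ww'].
rewrite -{w'}ww' in wl.
have Hl := perm_to_rem wl; exists M, (rem (w, M) l); split=> //.
rewrite -(perm_cons w); apply: perm_trans H; rewrite perm_sym.
apply: (perm_trans (y := b :: w :: unzip1 (rem (w, M) l))).
  by rewrite perm_cons; apply: (perm_map fst Hl).
exact: perm_swap.
Qed.

(** Modulo [w] and any powers of the members of [p], the element [a] is nilpotent. Hence
    [qnzd_exchange] cancels [w], and [qnzd_exchange_other] cancels members of [p]. *)
Lemma quasi_regular_exchange a w p t : quasi_regular (a :: p) ->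
  gen [set 0] (w :: p) (a ^+ t) -> quasi_regular (w :: p).
Proof.
move=> H Hw.
have nilw l : perm_eq (unzip1 l) p ->
    exists t', adjoin (gen [set 0] (powers l)) w (a ^+ t').
  move=> lp; have := Hw; rewrite /= -(perm_gen id0 lp) -gen_adjoin.
  move=> /(powers_nil (ideal_adjoin w id0)) [t' Ht']; exists (t * t')%N.
  by rewrite exprM -gen_adjoin.
move=> b l bl; have [bw|bw] := eqVneq b w.
  move: bl; rewrite bw perm_cons => lp; have [t' Ht'] := nilw _ lp.
  apply: (qnzd_exchange (a := a)) Ht'; first exact: ideal_gen.
  by apply: H; rewrite perm_cons.
have [M [l' [ll' bl']]] := perm_unzip_cons bw bl.
rewrite (perm_gen_powers id0 ll') /=.
have idl' : ideal (gen [set 0] (powers l')) by apply: ideal_gen.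
apply: (qnzd_exchange_other (a := a)) => // k.
- apply: (H b ((a, k) :: l')) => /=.
  apply: (perm_trans (y := a :: b :: unzip1 l')); last by rewrite perm_cons.
  exact: perm_swap.
- by apply: (H a ((b, k) :: l')); rewrite /= perm_cons.
- exact: (nilw ((b, k) :: l')).
Qed.

(** The entries of [l1] receive their exponents one at a time by [nzd_adjoin_expS]; those of [s2]
    still have exponent 1. *)
Lemma nzd_powers a xs l1 s2 : quasi_regular xs -> nzd (gen [set 0] xs) a ->
  perm_eq (unzip1 l1 ++ s2) xs -> nzd (gen (gen [set 0] s2) (powers l1)) a.
Proof.
move=> Hx Ha; elim: l1 s2 => [|[b k] l1 IH] s2 /= Hp.
  by rewrite (perm_gen id0 Hp).
set O := gen (gen _ _) _.
have idO : ideal O by apply/ideal_gen/ideal_gen.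
have Hb : qnzd O b.
  have -> : O = gen [set 0] (powers (l1 ++ [seq (x, 1%N) | x <- s2])).
    rewrite /powers map_cat gen_cat -map_comp /O; congr (gen (gen _ _) _).
    by rewrite -[LHS]map_id; apply: eq_map => x /=; rewrite expr1.
  apply: Hx; rewrite /unzip1 map_cat -map_comp.
  by have -> : [seq (fst \o (fun x => (x, 1%N))) i | i <- s2] = s2 by rewrite map_id.
have H1 : nzd (adjoin O b) a.
  rewrite /O -gen_adjoin; apply: (IH (b :: s2)).
  apply: perm_trans Hp; rewrite -[b :: _ ++ _]/([:: b] ++ _ ++ _).
  by rewrite -[b :: s2]/([:: b] ++ s2) perm_catCA.
elim: k {Hp} => [|k IHk]; last exact: nzd_adjoin_expS.
by move=> r _; exists r; rewrite mulr1 subrr; apply: ideal0.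
Qed.

Lemma quasi_regular_cons a xs : quasi_regular xs -> nzd (gen [set 0] xs) a ->
  quasi_regular (a :: xs).
Proof.
move=> Hx Ha b l bl; have [ba|ba] := eqVneq b a.
  move: bl; rewrite ba perm_cons => lp; apply: nzd_qnzd.
  by apply: (nzd_powers (s2 := [::]) Hx Ha); rewrite cats0.
have [M [l' [ll' bl']]] := perm_unzip_cons ba bl.
rewrite (perm_gen_powers id0 ll') /=.
apply: qnzd_adjoin_nzd; [exact: ideal_gen|exact: Hx|].
rewrite -adjoin_exp1.
by apply: (nzd_powers (l1 := (b, 1%N) :: l') (s2 := [::]) Hx Ha); rewrite cats0.
Qed.

Lemma weakly_regular_quasi_regular xs :
  (forall i, (i < size xs)%N -> nzd (gen [set 0] (take i xs)) xs`_i) ->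
  quasi_regular xs.
Proof.
move=> H.
suff Hi i : (i <= size xs)%N -> quasi_regular (take i xs).
  by rewrite -(take_size xs); apply: Hi.
elim: i => [|i IH] ix; first by rewrite take0 => a l /perm_size.
rewrite (take_nth 0 ix).
apply: (quasi_regular_perm (xs := xs`_i :: take i xs)).
  by rewrite perm_sym perm_rcons.
by apply: quasi_regular_cons; [exact/IH/ltnW|exact: H].
Qed.

(** Multiplication by [x] embeds [R/(O, x^n)] in [(O, x)/(O, x^(n+1))], so each further power of [x]
    adds [e]. *)
Lemma qnzd_len_ge O x e n : ideal O -> qnzd O x ->
  len_ge [set: R] (adjoin O x) e -> len_ge [set: R] (adjoin O (x ^+ n)) (n * e).
Proof.
move=> idO Hx H; elim: n => [|n IHn]; first exact: len_ge_nil.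
rewrite mulSn addnC; apply: len_ge_trans H.
- exact: ideal_adjoin.
- apply: adjoin_sub; [exact: ideal_adjoin|exact: sub_adjoin|].
  by rewrite exprSr; apply: mem_adjoin.
- by [].
apply: (len_ge_scale (x := x)) IHn.
- exact: Hx.
- exact: ideal_adjoin.
- by move=> u _; apply: mem_adjoin.
- apply: adjoin_sub; [exact: ideal_adjoin|exact: sub_adjoin|].
  by rewrite exprSr; apply: mem_adjoin.
- exact: ideal_adjoin.
Qed.

Lemma quasi_regular_len_ge xs e q : quasi_regular xs ->
  len_ge [set: R] (gen [set 0] xs) e ->
  len_ge [set: R] (gen [set 0] [seq x ^+ q | x <- xs]) (q ^ size xs * e).
Proof.
move=> Hx He.
suff H s1 s2 : perm_eq (s1 ++ s2) xs ->
    len_ge [set: R] (gen (gen [set 0] s2) [seq x ^+ q | x <- s1]) (q ^ size s1 * e).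
  by apply: (H xs [::]); rewrite cats0.
elim: s1 s2 => [|x s1 IH] s2 /= Hp.
  by rewrite expn0 mul1n (perm_gen id0 Hp).
rewrite expnS -mulnA; apply: qnzd_len_ge; first exact/ideal_gen/ideal_gen.
  rewrite -gen_cat.
  have -> : [seq y ^+ q | y <- s1] ++ s2 =
      powers ([seq (y, q) | y <- s1] ++ [seq (y, 1%N) | y <- s2]).
    rewrite /powers map_cat -!map_comp; congr (_ ++ _).
    by rewrite -[LHS]map_id; apply: eq_map => y /=; rewrite expr1.
  apply: Hx; rewrite /unzip1 map_cat -!map_comp.
  by rewrite [map _ s1]map_id [map _ s2]map_id.
rewrite -gen_adjoin; apply: (IH (x :: s2)).
apply: perm_trans Hp; rewrite -[x :: _ ++ _]/([:: x] ++ _ ++ _).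
by rewrite -[x :: s2]/([:: x] ++ s2) perm_catCA.
Qed.

End QuasiRegular.

(** * Forms and reductions *)

(** These have total degree at most [n]; they index the monomials of degree exactly [n] in one more
    variable, the [z] of [monomial]. *)
Fixpoint exponents (d n : nat) : seq (seq nat) :=
  if d is d'.+1 then
    [seq j :: a | j <- iota 0 n.+1, a <- exponents d' (n - j)]
  else [:: [::]].

Lemma exponentsS d n : exponents d.+1 n =
  [seq j :: a | j <- iota 0 n.+1, a <- exponents d (n - j)].
Proof. by []. Qed.

Arguments exponents : simpl never.

Lemma exponents_uniq d n : uniq (exponents d n).
Proof.
elim: d n => [|d IH] n //; rewrite exponentsS.
apply: (@allpairs_uniq_dep _ _ _ (fun j a => j :: a) (iota 0 n.+1)
  (fun j => exponents d (n - j))) => //; first exact: iota_uniq.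
by move=> [j a] [j' a'] /= _ _ [-> ->].
Qed.

Lemma size_exponents_ge d n M : (d * M <= n)%N -> (M ^ d <= size (exponents d n))%N.
Proof.
elim: d n => [|d IH] n Mn //; rewrite exponentsS.
rewrite size_allpairs_dep sumnE big_map.
have -> : iota 0 n.+1 = iota 0 M ++ iota M (n.+1 - M).
  by rewrite -[in iota M _](add0n M) -iotaD; congr iota; lia.
rewrite big_cat /=; apply: leq_trans (leq_addr _ _).
have -> : (M ^ d.+1 = \sum_(j <- iota 0 M) M ^ d)%N.
  by rewrite big_const_seq count_predT size_iota iter_addn_0 mulnC expnS.
rewrite big_seq [leqRHS]big_seq; apply: leq_sum => j.
rewrite mem_iota => jM; apply: IH; lia.
Qed.

Section Forms.
Variable R : comNzRingType.
Implicit Types (I J K L O Y : set R) (b u v w x y z : R) (xs ys cs s : seq R).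

(* The exponents of [xs] are listed by [a]; that of [z] makes the degree [n]. *)
Fixpoint monomial xs z n (a : seq nat) : R :=
  match xs, a with
  | x :: xs', j :: a' => x ^+ j * monomial xs' z (n - j)%N a'
  | _, _ => z ^+ n
  end.

Definition form xs z n (r : seq nat -> R) : R :=
  \sum_(a <- exponents (size xs) n) r a * monomial xs z n a.

Lemma form_cons c cs n (r : seq nat -> R) : form (c :: cs) 1 n r =
  (\poly_(j < n.+1) form cs 1 (n - j) (fun a => r (j :: a))).[c].
Proof.
rewrite /form [size (c :: cs)]/= exponentsS big_allpairs_dep horner_poly.
rewrite -[iota 0 n.+1]/(index_iota 0 n.+1) big_mkord.
apply: eq_bigr => j _; rewrite mulr_suml; apply: eq_bigr => a _ /=.
by rewrite mulrCA mulrC.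
Qed.

Lemma monomial_mem K xs z n a : (forall x, x \in xs -> K x) -> K z ->
  a \in exponents (size xs) n -> ideal_pow K n (monomial xs z n a).
Proof.
elim: xs n a => [|x xs IH] n a Kxs Kz.
  by move=> _; apply: mem_ideal_pow.
rewrite exponentsS => /allpairsPdep [j [a' [jn a'n ->]]] /=.
have -> : n = (j + (n - j))%N by move: jn; rewrite mem_iota; lia.
apply: ideal_powD; first by apply: mem_ideal_pow; apply: Kxs; rewrite inE eqxx.
have -> : (j + (n - j) - j = n - j)%N by lia.
by apply: IH => // y ys; apply: Kxs; rewrite inE ys orbT.
Qed.

Definition shift xs cs z : seq R := [seq t.1 - t.2 * z | t <- zip xs cs].

Lemma ideal_mul_pow Y K i j a b : ideal_mul Y (ideal_pow K i) a ->
  ideal_pow K j b -> ideal_mul Y (ideal_pow K (i + j)) (a * b).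
Proof.
move=> Ha Kb; move: a Ha.
suff: ideal_mul Y (ideal_pow K i) `<=`
  [set u | ideal_mul Y (ideal_pow K (i + j)) (u * b)] by [].
apply: ideal_mul_sub; first exact/ideal_colon/ideal_ideal_mul.
move=> u v Yu Kv /=; rewrite -mulrA; apply: mem_ideal_mul => //.
exact: ideal_powD.
Qed.

Lemma ideal_mulS Y Y' K K' : Y `<=` Y' -> K `<=` K' ->
  ideal_mul Y K `<=` ideal_mul Y' K'.
Proof.
move=> YY KK; apply: ideal_mul_sub; first exact: ideal_ideal_mul.
by move=> a b /YY Ya /KK Kb; apply: mem_ideal_mul.
Qed.

(** Modulo the shifted elements each [x] equals [c * z]. Replacing one factor at a time leaves an
    error with one factor among the shifts and [n - 1] factors in [K]. *)
Lemma monomial_congr K xs cs z n a : ideal K -> size cs = size xs ->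
  (forall x, x \in xs -> K x) -> K z -> a \in exponents (size xs) n ->
  ideal_mul (gen [set 0] (shift xs cs z)) (ideal_pow K n.-1)
    (monomial xs z n a - z ^+ n * monomial cs 1 n a).
Proof.
move=> idK; elim: xs cs n a => [|x xs IH] [|c cs] n a //=.
  move=> _ _ _ _; rewrite expr1n mulr1 subrr.
  by apply: ideal0; apply: ideal_ideal_mul.
move=> [szc] Kxs Kz; rewrite exponentsS => /allpairsPdep [j [a' [jn a'n ->]]] /=.
have Kx : K x by apply: Kxs; rewrite inE eqxx.
have {}Kxs y : y \in xs -> K y by move=> ys; apply: Kxs; rewrite inE ys orbT.
have jn' : (j <= n)%N by move: jn; rewrite mem_iota; lia.
set Y := adjoin _ _; set M := monomial xs _ _ _; set N := monomial cs _ _ _.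
have -> : x ^+ j * M - z ^+ n * (c ^+ j * N) =
  (x ^+ j - (c * z) ^+ j) * M + (M - z ^+ (n - j) * N) * (c ^+ j * z ^+ j).
  have -> : z ^+ n = z ^+ (n - j) * z ^+ j by rewrite -exprD subnK.
  by rewrite exprMn; ring.
have idYK i : ideal (ideal_mul Y (ideal_pow K i)) by apply: ideal_ideal_mul.
apply: (idealD (I := ideal_mul Y (ideal_pow K n.-1))) => //.
  rewrite subrXX -mulrA; case: j jn jn' @M @N a'n => [|j] jn jn' M N a'n.
    by rewrite big_ord0 mul0r mulr0; apply: ideal0.
  apply: mem_ideal_mul; first by apply: mem_adjoin1; apply: ideal_gen; apply: ideal_zero.
  have -> : n.-1 = (j + (n - j.+1))%N by lia.
  apply: ideal_powD; last exact: monomial_mem.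
  apply: ideal_sum => [|i _]; first exact: ideal_ideal_pow.
  case: i => i ij /=; rewrite -[X in ideal_pow K X](subnK (n := j) (m := i)) //.
  by apply: ideal_powD; apply: mem_ideal_pow => //; apply: ideal_mulr.
have H := IH cs (n - j)%N a' szc Kxs Kz a'n.
have Kcz : ideal_pow K j (c ^+ j * z ^+ j).
  by apply: ideal_mulr; [exact: ideal_ideal_pow|exact: mem_ideal_pow].
have := ideal_mul_pow H Kcz; apply: ideal_mulS; first exact: sub_adjoin.
apply: ideal_pow_leq; lia.
Qed.

Lemma form_congr K xs cs z n r : ideal K -> size cs = size xs ->
  (forall x, x \in xs -> K x) -> K z ->
  ideal_mul (gen [set 0] (shift xs cs z)) (ideal_pow K n.-1)
    (form xs z n r - z ^+ n * form cs 1 n r).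
Proof.
move=> idK szc Kxs Kz; rewrite /form szc mulr_sumr -sumrB.
apply: ideal_seqsum => [|a ha]; first exact: ideal_ideal_mul.
rewrite mulrCA -mulrBr; apply: (ideal_mulr (I := ideal_mul _ _)); first exact: ideal_ideal_mul.
exact: monomial_congr.
Qed.

Lemma shift_gen xs cs z : size cs = size xs ->
  gen [set 0] (z :: xs) `<=` adjoin (gen [set 0] (shift xs cs z)) z.
Proof.
move=> szc; have id0 := @ideal_zero R.
set Y := gen _ (shift _ _ _).
have idY : ideal (adjoin Y z) by apply/ideal_adjoin/ideal_gen.
apply: gen_sub => // [_ ->|x]; first exact: ideal0.
rewrite inE => /predU1P[->|xs_x]; first by apply: mem_adjoin1; apply: ideal_gen.
have ix : (index x xs < size xs)%N by rewrite index_mem.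
exists cs`_(index x xs).
have -> : x - cs`_(index x xs) * z = (shift xs cs z)`_(index x xs).
  rewrite /shift (nth_map (0, 0)) ?size_zip ?szc ?minnn //.
  by rewrite nth_zip //= nth_index.
apply: mem_gen => //; apply: mem_nth.
by rewrite size_map size_zip szc minnn.
Qed.

Lemma shift_sub K xs cs z y : ideal K -> (forall x, x \in xs -> K x) -> K z ->
  y \in shift xs cs z -> K y.
Proof.
move=> idK + Kz; elim: xs cs => [|x xs IH] [|c cs] //= Kxs.
rewrite inE => /predU1P[->|].
  by apply: idealB => //; [apply: Kxs; rewrite inE eqxx|apply: ideal_mulr].
by apply: IH => u ux; apply: Kxs; rewrite inE ux orbT.
Qed.

(** As [K] is inside [Y + (z)], a product of [n] elements of [K] is a multiple of [z^n] up to terms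
    with a factor in [Y]. *)
Lemma pow_sub_adjoin K Y z n : ideal K -> Y `<=` K -> K z -> K `<=` adjoin Y z ->
  ideal_pow K n `<=` adjoin (ideal_mul Y (ideal_pow K n.-1)) (z ^+ n).
Proof.
move=> idK YK Kz KY; have idYK i := @ideal_ideal_mul _ Y (ideal_pow K i).
elim: n => [|n IHn].
  by move=> v _; exists v; rewrite mulr1 subrr; apply: ideal0.
apply: ideal_powS_sub; first exact: ideal_adjoin.
move=> a b /KY [t Yt] Kb; have -> : a * b = (a - t * z) * b + b * (t * z) by ring.
apply: idealD; first exact: ideal_adjoin.
  by apply: sub_adjoin; apply: mem_ideal_mul.
have [v Hv] := IHn _ Kb; exists (v * t).
have -> : b * (t * z) - v * t * z ^+ n.+1 = (b - v * z ^+ n) * (t * z).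
  by rewrite exprSr; ring.
have Ktz : ideal_pow K 1 (t * z) by rewrite ideal_pow1 //; apply: ideal_mulr.
have := ideal_mul_pow Hv Ktz; apply: ideal_mulS => //; apply: ideal_pow_leq.
by case: n {IHn Kb Hv} => [|n] /=; lia.
Qed.

End Forms.

(** * Relations between monomials by counting lengths *)

Section Relations.
Variables (R : comNzRingType) (m : set R).
Hypothesis idm : ideal m.
Hypothesis m1 : ~ m 1.
Hypothesis munit : forall a, ~ m a -> exists b, b * a = 1.
Implicit Types (I J K L O Y : set R) (b u v w x y z : R) (xs ys cs s p : seq R).

Lemma local_nmemM u v : ~ m u -> ~ m v -> ~ m (u * v).
Proof.
move=> /munit [b bu] nv muv; apply: nv.
by rewrite -[v]mul1r -bu -mulrA; apply: ideal_mulr.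
Qed.

(** No relation has a coefficient outside [m], so each [g a], when adjoined in turn, makes a strict
    step. *)
Lemma len_ge_independent (A : eqType) (E : seq A) (g : A -> R) I : ideal I ->
  uniq E ->
  (forall r, (exists2 a, a \in E & ~ m (r a)) -> ~ I (\sum_(a <- E) r a * g a)) ->
  len_ge (gen I [seq g a | a <- E]) I (size E).
Proof.
elim: E I => [|a E IH] I idI /=; first by move=> _ _; exact: len_ge_nil.
move=> /andP[aE uE] H; have idIa := ideal_adjoin (g a) idI.
rewrite -gen_adjoin; apply: (len_ge_cons idIa) (IH _ idIa uE _).
- exact: sub_gen.
- exact: sub_adjoin.
- move=> /(_ _ (mem_adjoin1 (g a) idI)) Iga.
  have /H : exists2 b, b \in a :: E & ~ m (if b == a then 1 else 0).
    by exists a; rewrite ?inE eqxx.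
  apply.
  rewrite big_cons eqxx mul1r big_seq big1 ?addr0 // => b bE.
  by case: eqP bE aE => [-> ->|_ _ _] //; rewrite mul0r.
- move=> r [b bE mb] [c Ic].
  have /H : exists2 b, b \in a :: E & ~ m (if b == a then - c else r b).
    exists b; first by rewrite inE bE orbT.
    by case: eqP bE aE => [-> ->|].
  apply; rewrite big_cons eqxx mulNr addrC.
  rewrite (_ : \sum_(j <- E) _ = \sum_(a <- E) r a * g a) //.
  rewrite big_seq [RHS]big_seq; apply: eq_bigr => e eE.
  by case: eqP eE aE => [-> ->|].
Qed.

Lemma len_le_gen_exp O xs e q : ideal O -> len_le m [set: R] (gen O xs) e ->
  len_le m [set: R] (gen O [seq x ^+ q | x <- xs]) (q ^ size xs * e).
Proof.
elim: xs O => [|x xs IH] O idO /= H; first by rewrite expn0 mul1n.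
rewrite expnS -mulnA; apply: len_le_pow; first exact: ideal_gen.
rewrite -gen_adjoin; apply: IH; first exact: ideal_adjoin.
by rewrite gen_adjoin.
Qed.

(** Without a relation, each layer [K^n / K^(n+1)] modulo [O] has length at least the number of
    monomials of degree [n] in [d + 1] variables. Then the length of [R/(O + K^N)] grows like
    [N^(d+1)], whereas the powers [x^N] bound it by [N^d * e]. *)
Lemma exists_relation O xs z e : ideal O ->
  (forall x, x \in xs -> m x) -> m z ->
  len_le m [set: R] (gen O xs) e ->
  let K := gen [set 0] (z :: xs) in
  exists n r, (exists2 a, a \in exponents (size xs) n.+1 & ~ m (r a)) /\
    ideal_add O (ideal_mul m (ideal_pow K n.+1)) (form xs z n.+1 r).
Proof.
move=> idO mxs mz He K; set d := size xs.
have id0 := @ideal_zero R.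
have idK : ideal K by apply: ideal_gen.
have Kz : K z by apply: mem_gen; rewrite ?inE ?eqxx.
have Kxs x : x \in xs -> K x.
  by move=> xxs; apply: mem_gen; rewrite ?inE ?xxs ?orbT.
apply: contrapT => nrel.
have Km : K `<=` m.
  apply: gen_sub => // [_ ->|x]; first exact: ideal0.
  by rewrite inE => /predU1P[->|/mxs].
have idOK n := ideal_ideal_add idO (@ideal_ideal_pow _ K n).
have Hstep n : len_ge (ideal_add O (ideal_pow K n.+1))
    (ideal_add O (ideal_pow K n.+2)) (size (exponents d n.+1)).
  have idmK : ideal (ideal_mul m (ideal_pow K n.+1)) by apply: ideal_ideal_mul.
  have idOmK := ideal_ideal_add idO idmK.
  apply: (@len_geS _ _ _ (ideal_add O (ideal_mul m (ideal_pow K n.+1)))).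
    apply: ideal_add_sub => //; first exact: sub_ideal_addl.
    apply: subset_trans (sub_ideal_addr idO).
    apply: ideal_powS_sub => // a b Ka Kb.
    by apply: mem_ideal_mul => //; apply: Km.
  apply: len_ge_sub (len_ge_independent (g := monomial xs z n.+1) idOmK
    (exponents_uniq d n.+1) _).
    apply: gen_sub => //.
      apply: ideal_add_sub => //; first exact/sub_ideal_addl/ideal_ideal_pow.
      apply: subset_trans (sub_ideal_addr idO).
      apply: ideal_mul_sub => [|a b _ Kb]; first exact: ideal_ideal_pow.
      by apply: (ideal_mulr (I := ideal_pow _ _)) => //; apply: ideal_ideal_pow.
    move=> _ /mapP [a aE ->]; apply: (sub_ideal_addr idO).
    exact: monomial_mem.
  by move=> r rE Hr; apply: nrel; exists n, r.
(* Chosen so that the lower bound [M * M^d] beats [((d + 2) * M)^d * e], which dominates the upper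
   bound for the power [d * M + M + 1] of [K]. *)
pose M := (e * d.+2 ^ d).+1.
have Hlow k : len_ge [set: R] (ideal_add O (ideal_pow K (d * M + k).+1)) (k * M ^ d).
  elim: k => [|k IHk]; first exact: len_ge_nil.
  rewrite mulSn addnS; apply: len_ge_trans IHk => //.
    apply: ideal_add_sub => //; first exact/sub_ideal_addl/ideal_ideal_pow.
    apply: subset_trans (sub_ideal_addr idO); exact: ideal_pow_leq.
  apply: len_ge_geq (Hstep _).
  by apply: size_exponents_ge; rewrite -addnS leq_addr.
have Hup : len_le m [set: R] (ideal_add O (ideal_pow K (d * M + M).+1))
    ((d * M + M).+1 ^ d * e).
  apply: len_leS (len_le_gen_exp _ idO He).
  apply: gen_sub => //; first exact/sub_ideal_addl/ideal_ideal_pow.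
  move=> _ /mapP [x /Kxs Kx ->]; apply: (sub_ideal_addr idO).
  exact: mem_ideal_pow.
have := len_le_ge munit (idOK _) Hup (Hlow M).
apply/negP; rewrite -ltnNge.
apply: (@leq_ltn_trans ((d.+2 * M) ^ d * e)).
  have M0 : (0 < M)%N by [].
  rewrite leq_mul2r; apply/orP; right.
  case: (posnP d) => [->|d0]; first by rewrite !expn0.
  rewrite leq_exp2r //; nia.
rewrite expnMn mulnAC ltn_mul2r expn_gt0 /= mulnC; exact: ltnSn.
Qed.

End Relations.

(** * General linear changes and reductions *)

Section Reductions.
Variables (R : comNzRingType) (m : set R) (c_ : nat -> R).
Hypothesis idm : ideal m.
Hypothesis m1 : ~ m 1.
Hypothesis munit : forall a, ~ m a -> exists b, b * a = 1.
Hypothesis c_inj : forall i j, i <> j -> ~ m (c_ i - c_ j).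
Implicit Types (I J K L O Y : set R) (b u v w x y z : R) (xs ys cs s p : seq R).

Let id0 := @ideal_zero R.

(** Let [f] be the value of the form at [cs]. The form is [f * z^n] modulo [Y K^(n-1)] and [u * z^n]
    with [u] in [m] by hypothesis, both modulo the right-hand side. As [f - u] is a unit, [z^n] lies
    there too, and it generates [K^n] up to [Y K^(n-1)]. *)
Lemma pow_sub_of_form O xs cs z n r : ideal O ->
  (forall x, x \in xs -> m x) -> m z -> size cs = size xs ->
  let K := gen [set 0] (z :: xs) in
  ideal_add O (ideal_mul m (ideal_pow K n)) (form xs z n r) ->
  ~ m (form cs 1 n r) ->
  ideal_pow K n `<=`
    ideal_add O (ideal_mul (gen [set 0] (shift xs cs z)) (ideal_pow K n.-1)).
Proof.
move=> idO mxs mz szc K Hf mf; set Y := gen _ (shift _ _ _).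
have idK : ideal K by apply: ideal_gen.
have Kz : K z by apply: mem_gen; rewrite ?inE ?eqxx.
have Kxs x : x \in xs -> K x.
  by move=> xxs; apply: mem_gen; rewrite ?inE ?xxs ?orbT.
have YK : Y `<=` K.
  apply: gen_sub => // [_ ->|y]; first exact: ideal0.
  exact: shift_sub.
have KY : K `<=` adjoin Y z by apply: shift_gen.
have idYK : ideal (ideal_mul Y (ideal_pow K n.-1)) by apply: ideal_ideal_mul.
set B := ideal_add _ _; have idB : ideal B by apply: ideal_ideal_add.
have YKB : ideal_mul Y (ideal_pow K n.-1) `<=` B by apply: sub_ideal_addr.
have KB := pow_sub_adjoin (n := n) idK YK Kz KY.
suff Bz : B (z ^+ n) by apply: subset_trans KB _; apply: adjoin_sub.
have sub : ideal_add O (ideal_mul m (ideal_pow K n)) `<=`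
    [set v | exists2 u, m u & B (v - u * z ^+ n)].
  have id' : ideal [set v | exists2 u, m u & B (v - u * z ^+ n)].
    apply/idealP; split.
    - by exists 0; [exact: ideal0|rewrite mul0r subr0; apply: ideal0].
    - move=> v w [u mu Bu] [t mt Bt]; exists (u + t); first exact: idealD.
      by rewrite mulrDl opprD addrACA; apply: idealD.
    - move=> a v [u mu Bu]; exists (a * u); first exact: ideal_mulr.
      by rewrite -mulrA -mulrBr; apply: ideal_mulr.
  apply: ideal_add_sub => // [v Ov|].
    exists 0; first exact: ideal0.
    by rewrite mul0r subr0; apply: (sub_ideal_addl idYK).
  apply: ideal_mul_sub => // u b mu /KB [t Ht]; exists (u * t).
    exact: ideal_mull.
  by rewrite -mulrA -mulrBr; apply/(ideal_mulr _ idB)/YKB.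
have [u mu Bu] := sub _ Hf.
set f := form cs 1 n r in mf.
have [v vu] : exists v, v * (f - u) = 1.
  by apply: munit => mfu; apply: mf; rewrite -(subrK u f); apply: idealD.
rewrite -[z ^+ n]mul1r -vu -mulrA; apply: ideal_mulr => //.
have -> : (f - u) * z ^+ n =
  (form xs z n r - u * z ^+ n) - (form xs z n r - z ^+ n * f) by ring.
apply: idealB => //; apply: YKB; exact: form_congr.
Qed.

(** This is the finiteness of roots over the residue field. If [P] has a value in [m] at [c_ l0],
    division by the corresponding linear factor leaves a smaller quotient that still has a
    coefficient outside [m]. *)
Lemma poly_eventually_nonroot (P : {poly R}) : (exists i, ~ m P`_i) ->
  exists B, forall l, (B <= l)%N -> ~ m P.[c_ l].
Proof.
have [N] := ubnP (size P); elim: N P => // N IH P /ltnSE sP [i mi].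
have [[l0 Hl0]|H] := pselect (exists l0, m P.[c_ l0]); last first.
  by exists 0%N => l _ Hl; apply: H; exists l.
have /factor_theorem [Q PQ] : root (P - P.[c_ l0]%:P) (c_ l0).
  by rewrite /root hornerD hornerN hornerC subrr.
have PE : P = Q * ('X - (c_ l0)%:P) + P.[c_ l0]%:P by rewrite -PQ subrK.
have mQ : exists j, ~ m Q`_j.
  apply: contrapT => nQ; apply: mi.
  have {}nQ j : m Q`_j by apply: contrapT => h; apply: nQ; exists j.
  rewrite PE coefD coefC mulrBr coefB coefMX coefMC.
  apply: idealD => //; last by case: ifP => _ //; apply: ideal0.
  apply: idealB => //; last exact: ideal_mull.
  by case: ifP => _ //; apply: ideal0.
have sQ : (size Q < N)%N.
  have [Q0|Q0] := eqVneq Q 0.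
    by have [j] := mQ; rewrite Q0 coef0 => /(_ (ideal0 idm)).
  have : size (P - P.[c_ l0]%:P) = (size Q).+1.
    by rewrite PQ size_Mmonic ?monicXsubC // size_XsubC addn2.
  have : (size (P - P.[c_ l0]%:P)%R <= N)%N.
    apply: leq_trans (size_polyD _ _) _; rewrite size_polyN geq_max sP /=.
    apply: leq_trans (size_polyC_leq1 _) _; apply: leq_trans sP.
    rewrite lt0n size_poly_eq0; apply/eqP => P0.
    by apply: mi; rewrite P0 coef0; apply: ideal0.
  by move=> sN sQ; rewrite sQ in sN.
have [B HB] := IH _ sQ mQ.
exists (maxn B l0.+1) => l; rewrite geq_max => /andP[Bl l0l] ml.
have : ~ m (Q.[c_ l] * (c_ l - c_ l0)).
  apply: local_nmemM => //; first exact: HB.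
  by apply: c_inj; lia.
apply; have -> : Q.[c_ l] * (c_ l - c_ l0) = P.[c_ l] - P.[c_ l0].
  by rewrite [in P.[c_ l]]PE !hornerE addrK.
exact: idealB.
Qed.

Lemma form_eventually_nonzero d n r cs j : (j <= n)%N -> size cs = d ->
  ~ m (form cs 1 (n - j) (fun a => r (j :: a))) ->
  exists B, forall l, (B <= l)%N -> ~ m (form (c_ l :: cs) 1 n r).
Proof.
move=> jn szc Hj.
have [|B HB] := @poly_eventually_nonroot
  (\poly_(i < n.+1) form cs 1 (n - i) (fun a => r (i :: a))).
  by exists j; rewrite coef_poly ltnS jn.
by exists B => l /HB; rewrite form_cons.
Qed.

(* The coordinates of the point are chosen one at a time, so each of them may
   also be required to avoid finitely many values depending on the others. *)
Lemma exists_nonzero_point d n r (A : seq R -> Prop) :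
  (exists2 a, a \in exponents d n & ~ m (r a)) -> A [::] ->
  (forall cs, (size cs < d)%N -> A cs ->
     exists B, forall l, (B <= l)%N -> A (c_ l :: cs)) ->
  exists cs, [/\ size cs = d, A cs & ~ m (form cs 1 n r)].
Proof.
elim: d n r => [|d IH] n r [a]; last first.
  rewrite exponentsS => /allpairsPdep [j [a' [jn a'n ->]]] mr A0 HA.
  have [|||cs [szc Acs Hcs]] := IH (n - j)%N (fun a => r (j :: a)) => //.
  - by exists a'.
  - by move=> cs szc; apply: HA; apply: ltnW.
  have [|B HB] := form_eventually_nonzero (r := r) (n := n) _ szc Hcs.
    by move: jn; rewrite mem_iota; lia.
  have [|B' HB'] := HA cs _ Acs; first by rewrite szc.
  exists (c_ (maxn B B') :: cs); split; first by rewrite /= szc.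
    by apply: HB'; rewrite leq_maxr.
  by apply: HB; rewrite leq_maxl.
rewrite inE => /eqP -> mr A0 _; exists [::]; split=> //.
by rewrite /form /= big_seq1 /= expr1n mulr1.
Qed.

(** The relation for the single element [x] is a polynomial in one variable. Wherever its value at
    [c_ l] is a unit, [pow_sub_of_form] puts a power of [x] in [O + (x - c_ l * z)]. *)
Lemma eventually_primary O x z e : ideal O -> m x -> m z ->
  len_le m [set: R] (adjoin O x) e ->
  exists B, forall l, (B <= l)%N -> exists t, adjoin O (x - c_ l * z) (x ^+ t).
Proof.
move=> idO mx mz He.
have mxs y : y \in [:: x] -> m y by rewrite inE => /eqP ->.
have [n [r [[a aE mr] Hr]]] := exists_relation idm m1 munit (xs := [:: x]) idO mxs mz He.
move: aE; rewrite exponentsS => /allpairsPdep [j [a' [jn]]].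
rewrite inE => /eqP -> aE; rewrite {}aE in mr.
have [|//||B HB] := @form_eventually_nonzero 0 n.+1 r [::] j.
- by move: jn; rewrite mem_iota; lia.
- by rewrite /form /= big_seq1 /= expr1n mulr1.
exists B => l /HB Hl; exists n.+1.
have := pow_sub_of_form idO mxs mz (erefl : size [:: c_ l] = size [:: x]) Hr Hl.
move=> /(_ (x ^+ n.+1)) [].
  by apply: mem_ideal_pow; apply: mem_gen => //; rewrite !inE eqxx orbT.
move=> u Ou [v Yv <-]; apply: idealD; first exact: ideal_adjoin.
  exact: sub_adjoin.
move: v Yv; apply: ideal_mul_sub; first exact: ideal_adjoin.
move=> y b Yy _; apply: ideal_mull; first exact: ideal_adjoin.
move: y Yy; apply: gen_sub; first exact: ideal_adjoin.
  by move=> _ ->; apply: ideal0; apply: ideal_adjoin.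
by move=> y; rewrite inE => /eqP ->; apply: mem_adjoin1.
Qed.

(** The properties of a regular system of generators of an [m]-primary ideal that survive a general
    change of one member. *)
Definition good_params xs : Prop :=
  [/\ forall x, x \in xs -> m x, quasi_regular xs
    & exists e, len_le m [set: R] (gen [set 0] xs) e].

Lemma good_params_perm xs ys : perm_eq xs ys -> good_params xs -> good_params ys.
Proof.
move=> xy [mxs qxs [e He]]; split.
- by move=> x; rewrite -(perm_mem xy); apply: mxs.
- exact: quasi_regular_perm qxs.
- by exists e; rewrite -(perm_gen id0 xy).
Qed.

Lemma good_params_exchange x z p : good_params (x :: p) -> m z ->
  exists B, forall l, (B <= l)%N -> good_params ((x - c_ l * z) :: p).
Proof.
move=> [mxs qxs [e He]] mz; have mx : m x by apply: mxs; rewrite inE eqxx.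
have idp : ideal (gen [set 0] p) by apply: ideal_gen.
have [B HB] := eventually_primary idp mx mz He.
exists B => l /HB [t Ht]; split.
- move=> y; rewrite inE => /predU1P[->|yp].
    by apply: idealB => //; apply: ideal_mulr.
  by apply: mxs; rewrite inE yp orbT.
- exact: quasi_regular_exchange Ht.
- exists (t * e)%N; apply: len_leS (len_le_pow t idp He).
  apply: adjoin_sub Ht; first exact: ideal_adjoin.
  exact: sub_adjoin.
Qed.

(** All [x_i] become [x_i - c_i * z] for a point [cs] where the relation has unit value. They are
    changed one at a time, each [c_i] avoiding finitely many indices that could spoil
    [good_params]. *)
Lemma exists_reduction1 xs z : good_params xs -> m z ->
  exists ys, [/\ size ys = size xs, good_params ys
    & pow_equiv (gen [set 0] (z :: xs)) (gen [set 0] ys)].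
Proof.
move=> gxs mz; have [mxs qxs [e He]] := gxs.
have [n [r [Hr Hf]]] := exists_relation idm m1 munit id0 mxs mz He.
(* New coordinates are put at the front of [cs], so the entries of [xs] are shifted from the last to
   the first. *)
pose L cs := take (size xs - size cs) xs ++
  shift (drop (size xs - size cs) xs) cs z.
have [||cs [szc Acs Hcs]] := exists_nonzero_point (A := good_params \o L) Hr.
- by rewrite /= /L subn0 take_size drop_size /= cats0.
- move=> cs szc; rewrite /= /L; set k := (size xs - size cs)%N.
  have -> : k = (size xs - (size cs).+1).+1 by rewrite /k; lia.
  set k' := (size xs - (size cs).+1)%N => gk.
  have k'x : (k' < size xs)%N by rewrite /k'; lia.
  rewrite (drop_nth 0 k'x) /=.
  move: gk; rewrite (take_nth 0 k'x); set s := shift _ _ _ => gk.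
  have {gk} : good_params (xs`_k' :: take k' xs ++ s).
    apply: good_params_perm gk.
    by rewrite -cat_cons perm_cat2r perm_rcons.
  move=> /good_params_exchange /(_ mz) [B HB]; exists B => l /HB.
  apply: good_params_perm.
  by rewrite -[_ :: _ ++ _]/([:: _] ++ _ ++ _) perm_catCA.
move: Acs; rewrite /= /L szc subnn take0 drop0 /= => gys.
exists (shift xs cs z); split=> //; first by rewrite size_map size_zip szc minnn.
pose K := gen [set 0] (z :: xs); change (pow_equiv K (gen [set 0] (shift xs cs z))).
have idK : ideal K by apply: ideal_gen.
have idY : ideal (gen [set 0] (shift xs cs z)) by apply: ideal_gen.
apply: (pow_equiv_reduction (n := n)) => //.
  apply: gen_sub => // [_ ->|y]; first exact: ideal0.
  apply: shift_sub => // [x xxs|]; apply: mem_gen => //.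
    by rewrite inE xxs orbT.
  by rewrite inE eqxx.
apply: subset_trans (pow_sub_of_form id0 mxs mz szc Hf Hcs) _.
apply: ideal_add_sub => //; first exact: ideal_ideal_mul.
by move=> _ ->; apply: ideal0; apply: ideal_ideal_mul.
Qed.

Lemma gen_cat_add s p : gen [set 0] (s ++ p) =
  ideal_add (gen [set 0] p) (gen [set 0] s).
Proof.
have idp := ideal_gen p id0; have ids := ideal_gen s id0.
apply/seteqP; split.
  rewrite gen_cat; apply: gen_sub; first exact: ideal_ideal_add.
    exact: sub_ideal_addl.
  by move=> a as_; apply: (sub_ideal_addr idp); apply: mem_gen.
have idsp := ideal_gen (s ++ p) id0.
by apply: ideal_add_sub => //; apply: gen_subseq => // a;
  rewrite mem_cat => ->; rewrite ?orbT.
Qed.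

(** The elements of [zs] are absorbed one at a time, and the shifts of the powers add up. *)
Lemma exists_reduction xs zs : good_params xs -> (forall z, z \in zs -> m z) ->
  exists ys, [/\ size ys = size xs, good_params ys
    & pow_equiv (gen [set 0] (zs ++ xs)) (gen [set 0] ys)].
Proof.
elim: zs xs => [|z zs IH] xs gxs mzs; first by exists xs; split=> //; exact: pow_equiv_sub.
have mz : m z by apply: mzs; rewrite inE eqxx.
have [ys [szy gys eys]] := exists_reduction1 gxs mz.
have [|us [szu gus eus]] := IH ys gys.
  by move=> u uzs; apply: mzs; rewrite inE uzs orbT.
exists us; split; rewrite ?szu //; apply: pow_equiv_trans eus.
have -> : gen [set 0] ((z :: zs) ++ xs) = gen [set 0] (zs ++ z :: xs).
  by apply: perm_gen => //; rewrite perm_sym -(cat1s z xs) perm_catCA.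
rewrite !gen_cat_add -!/(gen _ (_ :: _)).
by apply: pow_equiv_add => //; apply: ideal_gen.
Qed.

End Reductions.

(** * The bound over a local ring with infinite residue field *)

(* The number of exponents in [0, q)^d of total degree [D]. *)
Fixpoint box_count (q d D : nat) : nat :=
  if d is d'.+1 then \sum_(0 <= j < minn q D.+1) box_count q d' (D - j)
  else (D == 0).

Section LocalBound.
Variables (R : comNzRingType) (m : set R) (c_ : nat -> R).
Hypothesis idm : ideal m.
Hypothesis m1 : ~ m 1.
Hypothesis munit : forall a, ~ m a -> exists b, b * a = 1.
Hypothesis c_inj : forall i j, i <> j -> ~ m (c_ i - c_ j).
Implicit Types (I J K L O Y : set R) (b u v w x y z : R) (xs ys cs s p : seq R).

Let id0 := @ideal_zero R.

Fixpoint box_monomials q xs D : seq R :=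
  if xs is x :: xs' then
    [seq x ^+ j * u | j <- index_iota 0 (minn q D.+1),
                      u <- box_monomials q xs' (D - j)%N]
  else if D == 0%N then [:: 1] else [::].

Lemma size_box_monomials q xs D :
  size (box_monomials q xs D) = box_count q (size xs) D.
Proof.
elim: xs D => [|x xs IH] D /=; first by case: eqP.
rewrite size_allpairs_dep sumnE big_map; apply: eq_bigr => j _; exact: IH.
Qed.

Lemma box_count_eq0 q d D : (d * q < D)%N -> box_count q d D = 0%N.
Proof.
elim: d D => [|d IH] D /=; first by case: D.
move=> dD; rewrite big_nat big1 // => j /andP[_ jq]; apply: IH; lia.
Qed.

Lemma pow_principal x j b : ideal_pow (gen [set 0] [:: x]) j b ->
  exists r, b = r * x ^+ j.
Proof.
elim: j b => [|j IHj] b; first by exists b; rewrite mulr1.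
move: b; apply: ideal_powS_sub => [|u v [t /= ut] /IHj [r ->]].
  apply/idealP; split; first by exists 0; rewrite mul0r.
    by move=> _ _ [r ->] [t ->]; exists (r + t); rewrite mulrDl.
  by move=> c _ [r ->]; exists (c * r); rewrite mulrA.
exists (t * r); have -> : u = t * x by apply/eqP; rewrite -subr_eq0 ut.
by rewrite exprS; ring.
Qed.

(** A factor [x^j] with [j >= q] vanishes modulo the [q]-th powers, which leaves the exponents in
    the box. *)
Lemma pow_sub_box_monomials q xs D : ideal_pow (gen [set 0] xs) D `<=`
  gen (gen [set 0] [seq x ^+ q | x <- xs]) (box_monomials q xs D).
Proof.
elim: xs D => [|x xs IH] D.
  case: D => [|D] /=; first by move=> u _; exists u; rewrite mulr1 subrr.
  by apply: ideal_powS_sub => // a b -> _; rewrite mul0r.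
set B := gen _ [seq _ | _ <- x :: xs]; have idB : ideal B by apply: ideal_gen.
have idT := ideal_gen (box_monomials q (x :: xs) D) idB.
rewrite -cat1s gen_cat_add; apply: ideal_pow_add => // i j a b ij Ha Hb.
rewrite mulrC.
have [r ->] := pow_principal Hb.
rewrite -mulrA; apply: ideal_mulr => //.
have [qj|jq] := leqP q j.
  rewrite mulrC; apply: ideal_mulr => //; apply: sub_gen.
  by rewrite -(subnK qj) exprD; apply: ideal_mulr => //; apply: mem_gen; rewrite ?inE ?eqxx.
move: a Ha.
suff : ideal_pow (gen [set 0] xs) i `<=` [set a | gen B (box_monomials q (x :: xs) D) (a * x ^+ j)].
  by move=> H a /H /=; rewrite mulrC.
apply: subset_trans (IH i) _; apply: gen_sub; first exact: ideal_colon.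
  move=> u Bu /=; apply: ideal_mull => //; apply: sub_gen.
  by move: u Bu; apply: sub_adjoin.
move=> u uM /=; apply: mem_gen => //; apply/allpairsPdep; exists j, u.
split; last by rewrite mulrC.
  by rewrite mem_index_iota leq_min jq /= -ij; lia.
by rewrite -ij addnK.
Qed.

Lemma len_le_gen_scale I J gs e : ideal I -> len_le m [set: R] J e ->
  (forall g u, g \in gs -> J u -> I (u * g)) ->
  len_le m (gen I gs) I (size gs * e).
Proof.
move=> + HJ; elim: gs I => [|g gs IH] I idI H /=; first exact: len_le_nil.
have Hg : len_le m (adjoin I g) I e.
  apply: (len_le_scale (x := g)) HJ => //.
  - by move=> u Ju; apply: H; rewrite ?inE ?eqxx.
  - move=> L idL IL HL v [r Ir]; rewrite -(subrK (r * g) v).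
    by apply: idealD => //; [exact: IL|apply: HL].
rewrite mulSn; apply: len_le_trans Hg _.
rewrite -gen_adjoin; apply: IH; first exact: ideal_adjoin.
by move=> g' u g's Ju; apply: sub_adjoin; apply: H; rewrite // inE g's orbT.
Qed.

Lemma box_monomials_mem q xs D u : u \in box_monomials q xs D ->
  ideal_pow (gen [set 0] xs) D u.
Proof.
elim: xs D u => [|x xs IH] D u /=; first by case: eqP => // ->.
move=> /allpairsPdep [j [v [jD vM ->]]].
have -> : D = (j + (D - j))%N by move: jD; rewrite mem_index_iota; lia.
apply: ideal_powD; first by apply: mem_ideal_pow; apply: mem_adjoin1; apply: ideal_gen.
apply: ideal_powS (IH _ _ vM); exact: sub_adjoin.
Qed.

(** The layer of degree [D] is generated by box monomials, each killed by [J] modulo the next layer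
    and so contributing at most [e]. *)
Lemma len_le_pow_box q xs e n k : len_le m [set: R] (gen [set 0] xs) e ->
  let J := gen [set 0] xs in let B := gen [set 0] [seq x ^+ q | x <- xs] in
  len_le m (ideal_add (ideal_pow J n) B) (ideal_add (ideal_pow J (n + k)) B)
    ((\sum_(n <= D < n + k) box_count q (size xs) D) * e).
Proof.
move=> He J B; have idB : ideal B by apply: ideal_gen.
have idJB D : ideal (ideal_add (ideal_pow J D) B).
  by apply: ideal_ideal_add => //; exact: ideal_ideal_pow.
elim: k => [|k IH].
  by rewrite addn0 big_geq //; apply: len_le_nil.
rewrite addnS big_nat_recr; last exact: leq_addr.
rewrite mulnDl [X in len_le _ _ _ X]addnC; set D := (n + k)%N; apply: (len_le_trans _ IH).
have Bsub i : B `<=` ideal_add (ideal_pow J i) B.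
  exact/sub_ideal_addr/ideal_ideal_pow.
rewrite -size_box_monomials.
apply: (len_le_sub (K := gen (ideal_add (ideal_pow J D.+1) B) (box_monomials q xs D))).
  have idg := ideal_gen (box_monomials q xs D) (idJB D.+1).
  apply: ideal_add_sub => //; last exact: subset_trans (Bsub _) (sub_gen _).
  apply: subset_trans (@pow_sub_box_monomials q xs D) _.
  by apply: genS; apply: Bsub.
apply: (len_le_gen_scale (J := J)) => // g u gM Ju.
apply: sub_ideal_addl => //; apply: mem_ideal_powS => //.
exact: (box_monomials_mem gM).
Qed.

(** A step [a] of the filtration of [R/I] becomes a step [a^q], killed by [m^n + m^[q]] modulo [I'].
    Additivity of the [q]-th power keeps [x^q] in [I'] for [x] in [I] when [a] and [a^q] are
    adjoined. *)
Lemma len_le_frobenius I I' n q e l : (0 < q)%N ->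
  (forall x y, (x + y) ^+ q = x ^+ q + y ^+ q) ->
  len_le m [set: R] I e -> ideal I -> ideal I' ->
  (forall x, I x -> I' (x ^+ q)) -> ideal_pow m n `<=` I' ->
  len_le m [set: R] (ideal_add (ideal_pow m n) (frobenius_pow m q)) l ->
  len_le m [set: R] I' (e * l).
Proof.
move=> q0 Fq + + + + + Hl; move=> H; elim: H I' => {I e} [I e TI|I a e ma _ IH] I' idI idI' II' mI'.
  apply: len_le_nil => x _; rewrite -[x]mulr1; apply: ideal_mulr => //.
  by rewrite -[1](expr1n _ q); apply/II'/TI.
rewrite mulSn.
have Ha : len_le m (adjoin I' (a ^+ q)) I' l.
  apply: (len_le_scale (x := a ^+ q)) Hl => //.
  - suff : ideal_add (ideal_pow m n) (frobenius_pow m q) `<=` [set u | I' (u * a ^+ q)] by [].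
    have idc := ideal_colon (a ^+ q) idI'.
    apply: ideal_add_sub => // [u /mI' Iu|]; first exact: ideal_mull.
    by apply: ideal_span_sub => // _ [u mu <-] /=; rewrite -exprMn; apply/II'/ma.
  - move=> L idL IL HL v [r Ir]; rewrite -(subrK (r * a ^+ q) v).
    by apply: idealD => //; [exact: IL|apply: HL].
apply: len_le_trans Ha _; apply: IH.
- exact: ideal_adjoin.
- exact: ideal_adjoin.
- move=> x [r Ix]; exists (r ^+ q).
  have -> : x ^+ q - r ^+ q * a ^+ q = (x - r * a) ^+ q.
    by have := Fq (x - r * a) (r * a); rewrite subrK => ->; rewrite exprMn addrK.
  exact: II'.
- by apply: subset_trans mI' _; apply: sub_adjoin.
Qed.

Lemma gen_exp xs q : (forall x y, (x + y) ^+ q = x ^+ q + y ^+ q) -> (0 < q)%N ->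
  forall x, gen [set 0] xs x -> gen [set 0] [seq y ^+ q | y <- xs] (x ^+ q).
Proof.
move=> Fq q0; elim: xs => [|y xs IH] x /=; first by move=> ->; rewrite expr0n; case: q q0 {Fq}.
move=> [r /IH Hr]; exists (r ^+ q).
have -> : x ^+ q - r ^+ q * y ^+ q = (x - r * y) ^+ q.
  by have := Fq (x - r * y) (r * y); rewrite subrK => ->; rewrite exprMn addrK.
exact: Hr.
Qed.

Lemma local_bound xs zs : m `<=` gen [set 0] zs -> (forall z, z \in zs -> m z) ->
  good_params m xs ->
  exists c, forall q n l, (0 < q)%N ->
    (forall x y, (x + y) ^+ q = x ^+ q + y ^+ q) ->
    len_le m [set: R] (ideal_add (ideal_pow m (n + c)) (frobenius_pow m q)) l ->
    (q ^ size xs <=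
     \sum_(n <= D < n + (size xs * q).+1) box_count q (size xs) D + l)%N.
Proof.
move=> mzs zsm gxs.
have [ys [szy [mys qys [e0 He0]] [c Hc]]] := exists_reduction idm m1 munit c_inj gxs zsm.
exists c => q n l q0 Fq Hl; rewrite -szy; set d := size ys.
set J := gen [set 0] ys in Hc He0.
have idJ : ideal J by apply: ideal_gen.
(* The exact length [e] of [R/J] enters both bounds and cancels at the end. *)
have [e [He1 He2]] := len_exact idJ He0.
have e0' : (0 < e)%N.
  case: e He1 {He2} => // He1; inversion He1 as [I k TJ|]; subst.
  case: m1; have : J 1 by apply: TJ.
  by apply: gen_sub => // _ ->; apply: ideal0.
pose B := gen [set 0] [seq x ^+ q | x <- ys].
have idB : ideal B by apply: ideal_gen.
have mJ : ideal_pow m (n + c) `<=` ideal_pow J n.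
  apply: subset_trans (Hc n); apply: ideal_powS.
  by apply: subset_trans mzs _; apply: gen_subseq => // z; rewrite mem_cat => ->.
have H1 : len_le m [set: R] (ideal_add (ideal_pow m (n + c)) B) (e * l).
  apply: (len_le_frobenius (n := (n + c)%N)) Hl => //; first exact: He1.
  - exact: idJ.
  - by apply: ideal_ideal_add => //; apply: ideal_ideal_pow.
  - by move=> x Jx; apply: sub_ideal_addr; [exact: ideal_ideal_pow|exact: gen_exp].
  - exact: sub_ideal_addl.
have H2 : len_le m [set: R] (ideal_add (ideal_pow J n) B) (e * l).
  apply: len_leS H1; apply: ideal_add_sub.
  - by apply: ideal_ideal_add => //; apply: ideal_ideal_pow.
  - by apply: subset_trans mJ _; apply: sub_ideal_addl.
  - by apply: sub_ideal_addr; apply: ideal_ideal_pow.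
have H3 := len_le_pow_box q n (d * q).+1 He1.
(* No box monomial has degree above [d * q], so the layers end here. *)
have JB : ideal_add (ideal_pow J (n + (d * q).+1)) B `<=` B.
  apply: ideal_add_sub => //; apply: subset_trans (@pow_sub_box_monomials q ys _) _.
  have -> : box_monomials q ys (n + (d * q).+1) = [::] => //.
  apply: size0nil; rewrite size_box_monomials; apply: box_count_eq0.
  by rewrite -/d; lia.
have H4 := len_le_trans (len_leS JB H3) H2.
have := len_le_ge munit idB H4 (quasi_regular_len_ge q qys He2).
by rewrite -/d [(e * l)%N]mulnC -mulnDl leq_pmul2r.
Qed.

End LocalBound.

(** * The extension R(t) *)

(** Zero is excluded so that the localization is a nonzero ring. *)
Record mult_set (A : comNzRingType) := MultSet {
  mult_set_mem :> A -> Prop;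
  mult_set1 : mult_set_mem 1;
  mult_setM : forall x y, mult_set_mem x -> mult_set_mem y -> mult_set_mem (x * y);
  mult_set0 : ~ mult_set_mem 0
}.

Section Localization.
Local Open Scope quotient_scope.
Variables (A : comNzRingType) (W : mult_set A).

Definition denominator := {g : A | `[< W g >]}.

Lemma denominatorP (g : denominator) : W (val g).
Proof. by apply/asboolP; apply: (valP g). Qed.

Definition denominator_of (g : A) (Wg : W g) : denominator :=
  exist _ g (asboolT Wg).

Definition denominator1 : denominator := denominator_of (mult_set1 W).

Definition denominatorM (g h : denominator) : denominator :=
  denominator_of (mult_setM (denominatorP g) (denominatorP h)).

(** The factor [w] allows for zero divisors in [W]. *)
Definition loc_equiv (x y : A * denominator) : bool :=
  `[< exists2 w, W w & w * (x.1 * val y.2 - y.1 * val x.2) = 0 >].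

Lemma loc_equiv_refl : reflexive loc_equiv.
Proof.
move=> x; apply/asboolP; exists 1; first exact: mult_set1.
by rewrite subrr mulr0.
Qed.

Lemma loc_equiv_sym : symmetric loc_equiv.
Proof.
move=> x y; apply/asboolP/asboolP => -[w Ww E]; exists w => //;
by rewrite -opprB mulrN E oppr0.
Qed.

Lemma loc_equiv_trans : transitive loc_equiv.
Proof.
move=> y x z /asboolP [w Ww E] /asboolP [v Wv F]; apply/asboolP.
exists (w * v * val y.2).
  by do 2?apply: mult_setM => //; apply: denominatorP.
have -> : w * v * val y.2 * (x.1 * val z.2 - z.1 * val x.2) =
  w * (x.1 * val y.2 - y.1 * val x.2) * (v * val z.2) +
  v * (y.1 * val z.2 - z.1 * val y.2) * (w * val x.2) by ring.
by rewrite E F !mul0r addr0.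
Qed.

Canonical loc_equiv_equiv :=
  EquivRel loc_equiv loc_equiv_refl loc_equiv_sym loc_equiv_trans.

Definition localization := {eq_quot loc_equiv}.
HB.instance Definition _ : EqQuotient _ loc_equiv localization :=
  EqQuotient.on localization.
HB.instance Definition _ := Choice.on localization.

Definition frac (f : A) (g : denominator) : localization := \pi_localization (f, g).

Lemma fracE f g f1 g1 : frac f g = frac f1 g1 <->
  exists2 w, W w & w * (f * val g1 - f1 * val g) = 0.
Proof.
split; first by move/eqquotP/asboolP.
by move=> H; apply/eqquotP/asboolP.
Qed.

Lemma eq_frac f g f' g' : f * val g' = f' * val g -> frac f g = frac f' g'.
Proof.
move=> E; apply/fracE; exists 1; first exact: mult_set1.
by rewrite E subrr mulr0.
Qed.

Lemma fracP (x : localization) : exists f g, x = frac f g.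
Proof. by exists (repr x).1, (repr x).2; rewrite /frac -surjective_pairing reprK. Qed.

Lemma frac_repr (x : localization) : x = frac (repr x).1 (repr x).2.
Proof. by rewrite /frac -surjective_pairing reprK. Qed.

Definition loc_add (x y : localization) : localization :=
  frac ((repr x).1 * val (repr y).2 + (repr y).1 * val (repr x).2)
       (denominatorM (repr x).2 (repr y).2).

Definition loc_opp (x : localization) : localization :=
  frac (- (repr x).1) (repr x).2.

Definition loc_mul (x y : localization) : localization :=
  frac ((repr x).1 * (repr y).1) (denominatorM (repr x).2 (repr y).2).

Lemma loc_addE f g f' g' : loc_add (frac f g) (frac f' g') =
  frac (f * val g' + f' * val g) (denominatorM g g').
Proof.
rewrite /loc_add; set x := repr _; set y := repr _.
have /fracE [w Ww E] : frac x.1 x.2 = frac f g by rewrite -frac_repr.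
have /fracE [v Wv F] : frac y.1 y.2 = frac f' g' by rewrite -frac_repr.
apply/fracE; exists (w * v); first exact: mult_setM.
rewrite /=.
have -> : w * v * ((x.1 * val y.2 + y.1 * val x.2) * (val g * val g') -
  (f * val g' + f' * val g) * (val x.2 * val y.2)) =
  w * (x.1 * val g - f * val x.2) * (v * val y.2 * val g') +
  v * (y.1 * val g' - f' * val y.2) * (w * val x.2 * val g) by ring.
by rewrite E F !mul0r addr0.
Qed.

Lemma loc_oppE f g : loc_opp (frac f g) = frac (- f) g.
Proof.
rewrite /loc_opp; set x := repr _.
have /fracE [w Ww E] : frac x.1 x.2 = frac f g by rewrite -frac_repr.
by apply/fracE; exists w => //; rewrite !mulNr -opprD mulrN E oppr0.
Qed.

Lemma loc_mulE f g f' g' : loc_mul (frac f g) (frac f' g') =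
  frac (f * f') (denominatorM g g').
Proof.
rewrite /loc_mul; set x := repr _; set y := repr _.
have /fracE [w Ww E] : frac x.1 x.2 = frac f g by rewrite -frac_repr.
have /fracE [v Wv F] : frac y.1 y.2 = frac f' g' by rewrite -frac_repr.
apply/fracE; exists (w * v); first exact: mult_setM.
rewrite /=.
have -> : w * v * (x.1 * y.1 * (val g * val g') - f * f' * (val x.2 * val y.2)) =
  w * (x.1 * val g - f * val x.2) * (v * y.1 * val g') +
  v * (y.1 * val g' - f' * val y.2) * (w * val x.2 * f) by ring.
by rewrite E F !mul0r addr0.
Qed.

Definition loc_zero := frac 0 denominator1.
Definition loc_one := frac 1 denominator1.

Lemma loc_addA : associative loc_add.
Proof.
move=> x y z; case: (fracP x) => a [b ->]; case: (fracP y) => c [d ->].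
case: (fracP z) => e [f ->]; rewrite !loc_addE; apply: eq_frac => /=; ring.
Qed.

Lemma loc_addC : commutative loc_add.
Proof.
move=> x y; case: (fracP x) => a [b ->]; case: (fracP y) => c [d ->].
rewrite !loc_addE; apply: eq_frac => /=; ring.
Qed.

Lemma loc_add0 : left_id loc_zero loc_add.
Proof.
move=> x; case: (fracP x) => a [b ->]; rewrite !loc_addE.
apply: eq_frac => /=; ring.
Qed.

Lemma loc_addN : left_inverse loc_zero loc_opp loc_add.
Proof.
move=> x; case: (fracP x) => a [b ->]; rewrite loc_oppE !loc_addE.
apply: eq_frac => /=; ring.
Qed.

HB.instance Definition _ :=
  GRing.isZmodule.Build localization loc_addA loc_addC loc_add0 loc_addN.

Lemma loc_mulA : associative loc_mul.
Proof.
move=> x y z; case: (fracP x) => a [b ->]; case: (fracP y) => c [d ->].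
case: (fracP z) => e [f ->]; rewrite !loc_mulE; apply: eq_frac => /=; ring.
Qed.

Lemma loc_mulC : commutative loc_mul.
Proof.
move=> x y; case: (fracP x) => a [b ->]; case: (fracP y) => c [d ->].
rewrite !loc_mulE; apply: eq_frac => /=; ring.
Qed.

Lemma loc_mul1 : left_id loc_one loc_mul.
Proof.
move=> x; case: (fracP x) => a [b ->]; rewrite !loc_mulE.
apply: eq_frac => /=; ring.
Qed.

Lemma loc_mulDl : left_distributive loc_mul loc_add.
Proof.
move=> x y z; case: (fracP x) => a [b ->]; case: (fracP y) => c [d ->].
case: (fracP z) => e [f ->]; rewrite !(loc_mulE, loc_addE).
apply: eq_frac => /=; ring.
Qed.

Lemma loc_one_neq0 : loc_one != loc_zero.
Proof.
apply/eqP => /fracE [w Ww]; rewrite mul0r subr0 /= !mulr1 => w0.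
by apply: (@mult_set0 _ W); rewrite -w0.
Qed.

HB.instance Definition _ := GRing.Zmodule_isComNzRing.Build localization
  loc_mulA loc_mulC loc_mul1 loc_mulDl loc_one_neq0.

Lemma fracD f g f' g' : frac f g + frac f' g' =
  frac (f * val g' + f' * val g) (denominatorM g g').
Proof. exact: loc_addE. Qed.

Lemma fracN f g : - frac f g = frac (- f) g.
Proof. exact: loc_oppE. Qed.

Lemma fracM f g f' g' : frac f g * frac f' g' = frac (f * f') (denominatorM g g').
Proof. exact: loc_mulE. Qed.

Definition loc_embed (f : A) : localization := frac f denominator1.

Lemma loc_embed_zmod : zmod_morphism loc_embed.
Proof.
by move=> f g; rewrite /loc_embed fracN fracD; apply: eq_frac => /=; ring.
Qed.

Lemma loc_embed_monoid : monoid_morphism loc_embed.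
Proof.
by split=> // f g; rewrite /loc_embed fracM; apply: eq_frac => /=; ring.
Qed.

HB.instance Definition _ :=
  GRing.isZmodMorphism.Build A localization loc_embed loc_embed_zmod.
HB.instance Definition _ :=
  GRing.isMonoidMorphism.Build A localization loc_embed loc_embed_monoid.

End Localization.

Lemma ideal_preimage (A B : comNzRingType) (f : {rmorphism A -> B}) (I : set B) :
  ideal I -> ideal (f @^-1` I).
Proof.
move=> idI; apply/idealP; split=> [|a b|a b]; rewrite /preimage /=.
- by rewrite rmorph0; apply: ideal0.
- by rewrite rmorphD; apply: idealD.
- by rewrite rmorphM; apply: ideal_mulr.
Qed.

(** * Ideals and lengths in R(t) *)

Section GenericExtension.
Variables (R : comNzRingType) (k : fieldType) (pi : {rmorphism R -> k}).
Implicit Types (I J K : set R) (a b : R) (s : seq R) (f h : {poly R}).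

(* The localization of [R[t]] at this set is the ring often written [R(t)];
   its residue field [k(t)] is infinite. *)
Lemma unimodular1 : map_poly pi 1 <> 0.
Proof. by rewrite rmorph1; apply/eqP; apply: oner_neq0. Qed.

Lemma unimodularM (f g : {poly R}) : map_poly pi f <> 0 -> map_poly pi g <> 0 ->
  map_poly pi (f * g) <> 0.
Proof.
by move=> /eqP f0 /eqP g0; apply/eqP; rewrite rmorphM mulf_neq0.
Qed.

Lemma unimodular0 : ~ map_poly pi 0 <> 0.
Proof. by rewrite rmorph0. Qed.

Definition unimodular : mult_set {poly R} :=
  MultSet unimodular1 unimodularM unimodular0.

Definition generic_ext : comNzRingType := localization unimodular.

Definition generic_embed : {rmorphism R -> generic_ext} :=
  loc_embed unimodular \o polyC.

Definition ext_ideal I : set generic_ext :=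
  [set x | exists f g, x = frac f g /\ forall i, I f`_i].

(** A fraction has many representatives, so a given numerator has its coefficients in [I] only up to
    a unimodular factor. *)
Lemma ext_idealE I f (g : denominator unimodular) : ideal I ->
  ext_ideal I (frac f g) -> exists2 w, map_poly pi w <> 0 & forall i, I (w * f)`_i.
Proof.
move=> idI [f' [g' [/fracE [w Ww E] If']]].
exists (w * val g'); first by apply: unimodularM => //; apply: (denominatorP g').
move=> i; have -> : w * val g' * f = w * val g * f'.
  apply/eqP; rewrite -subr_eq0 -E; apply/eqP; ring.
by rewrite coefM; apply: ideal_sum => // j _; apply: ideal_mulr.
Qed.

Lemma ext_ideal_mem I f (g : denominator unimodular) w : ideal I ->
  map_poly pi w <> 0 -> (forall i, I (w * f)`_i) -> ext_ideal I (frac f g).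
Proof.
move=> idI Ww Iwf; exists (w * f).
exists (denominatorM (denominator_of (W := unimodular) Ww) g); split=> //.
by apply: eq_frac => /=; ring.
Qed.

Lemma ideal_ext_ideal I : ideal I -> ideal (ext_ideal I).
Proof.
move=> idI.
have IM f h i : (forall i, I f`_i) -> I (f * h)`_i.
  by move=> If; rewrite coefM; apply: ideal_sum => // j _; apply: ideal_mull.
apply/idealP; split.
- exists 0, (denominator1 unimodular); split=> // i; rewrite coef0; exact: ideal0.
- move=> _ _ [f [g [-> If]]] [f' [g' [-> If']]]; rewrite fracD.
  exists (f * val g' + f' * val g), (denominatorM g g'); split=> // i.
  by rewrite coefD; apply: idealD => //; apply: IM.
- move=> x _ [f [g [-> If]]]; have [h [e ->]] := fracP x; rewrite fracM.
  exists (h * f), (denominatorM e g); split=> // i.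
  by rewrite mulrC; apply: IM.
Qed.

Lemma embed_ext_ideal I a : ideal I -> I a -> ext_ideal I (generic_embed a).
Proof.
move=> idI Ia; exists a%:P, (denominator1 unimodular); split=> // i.
by rewrite coefC; case: ifP => _ //; apply: ideal0.
Qed.

Lemma ext_ideal_sub I (J : set generic_ext) : ideal J ->
  (forall a, I a -> J (generic_embed a)) -> ext_ideal I `<=` J.
Proof.
move=> idJ IJ _ [f [g [-> If]]].
have -> : frac f g = loc_embed unimodular f * frac 1 g.
  by rewrite fracM; apply: eq_frac => /=; ring.
apply: ideal_mull => //; rewrite -[f]coefK poly_def rmorph_sum.
apply: ideal_sum => // i _; rewrite -mul_polyC rmorphM.
by apply: ideal_mull => //; apply: IJ.
Qed.

Lemma ext_ideal_gen s :
  ext_ideal (gen [set 0] s) = gen [set 0] [seq generic_embed a | a <- s].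
Proof.
have id0 := @ideal_zero R; have id0' := @ideal_zero generic_ext.
have ids := ideal_gen s id0.
have ids' := ideal_gen [seq generic_embed a | a <- s] id0'.
apply/seteqP; split.
- apply: ext_ideal_sub => //.
  suff : gen [set 0] s `<=` generic_embed @^-1` (gen [set 0] [seq generic_embed a | a <- s]) by [].
  apply: gen_sub.
  + exact: ideal_preimage.
  + by move=> _ ->; apply: ideal0; apply: ideal_preimage.
  + by move=> a a_s; apply: mem_gen => //; apply: map_f.
- apply: gen_sub.
  + exact: ideal_ext_ideal.
  + by move=> _ ->; apply: ideal0; apply: ideal_ext_ideal.
  + by move=> _ /mapP [a a_s ->]; apply: embed_ext_ideal => //; apply: mem_gen.
Qed.

Lemma nzd_ext I a : ideal I -> nzd I a -> nzd (ext_ideal I) (generic_embed a).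
Proof.
move=> idI Ha x; have [f [g ->]] := fracP x.
rewrite [_ * _]fracM => /(ext_idealE idI) [w Ww H].
apply: (ext_ideal_mem _ idI Ww) => i; apply: Ha.
by have := H i; rewrite mulrA coefMC.
Qed.

Let m : set R := [set a | pi a = 0].
Let M := ext_ideal m.

Lemma ideal_ker : ideal m.
Proof.
apply/idealP; split=> [|a b|a b]; rewrite /m /=.
- exact: rmorph0.
- by rewrite rmorphD => -> ->; rewrite addr0.
- by rewrite rmorphM => ->; rewrite mulr0.
Qed.

(** The reduction lands in the domain [k[t]], where the unimodular factor cancels. Hence a fraction
    outside [M] has an admissible denominator as numerator. *)
Lemma ext_kerE f (g : denominator unimodular) :
  M (frac f g) <-> map_poly pi f = 0.
Proof.
have kerP h : (forall i, m h`_i) <-> map_poly pi h = 0.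
  split=> [H|H i]; first by apply/polyP => i; rewrite coef_map coef0; apply: H.
  by rewrite /m /= -coef_map H coef0.
split=> [/(ext_idealE ideal_ker) [w /eqP Ww /kerP]|/kerP H].
  by rewrite rmorphM => /eqP; rewrite mulf_eq0 (negPf Ww) => /eqP.
by exists f, g.
Qed.

Lemma ext_ker1 : ~ M 1.
Proof. by move=> /ext_kerE; apply: unimodular1. Qed.

Lemma ext_ker_unit x : ~ M x -> exists y, y * x = 1.
Proof.
have [f [g ->]] := fracP x => nM.
have Wf : map_poly pi f <> 0 by move=> f0; apply: nM; apply/ext_kerE.
exists (frac (val g) (denominator_of (W := unimodular) Wf)).
by rewrite fracM; apply: eq_frac => /=; ring.
Qed.

(** The powers of [t] have distinct residues even if [k] is finite. *)
Definition generic_point (i : nat) : generic_ext := loc_embed unimodular 'X^i.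

Lemma generic_point_inj i j : i <> j -> ~ M (generic_point i - generic_point j).
Proof.
move=> ij; rewrite /generic_point -rmorphB => /ext_kerE.
rewrite rmorphB /= !map_polyXn => /eqP; rewrite subr_eq0 => /eqP E.
have := congr1 (fun q : {poly k} => q`_i) E; rewrite !coefXn eqxx.
by case: eqP => // _ /eqP; rewrite oner_eq0.
Qed.

Lemma len_le_ext I n : ideal I -> len_le m [set: R] I n ->
  forall I' : set generic_ext, ideal I' -> (forall a, I a -> I' (generic_embed a)) ->
  len_le M [set: generic_ext] I' n.
Proof.
move=> + H; elim: H => {I n} [I n TI|I a n ma _ IH] idI I' idI' II'.
  apply: len_le_nil => x _; rewrite -[x]mulr1; apply: ideal_mulr => //.
  by rewrite -(rmorph1 generic_embed); apply/II'/TI.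
apply: (len_le_cons (a := generic_embed a)).
  suff : M `<=` [set u | I' (u * generic_embed a)] by [].
  apply: ext_ideal_sub; first exact: ideal_colon.
  by move=> u mu; have := II' _ (ma _ mu); rewrite rmorphM.
apply: IH; [exact: ideal_adjoin|exact: ideal_adjoin|].
by move=> b [r Ib]; exists (generic_embed r); rewrite -rmorphM -rmorphB; apply: II'.
Qed.

End GenericExtension.

(** * Counting exponents *)

Section Counting.
Variable q : nat.

Definition box_sum (d n : nat) : nat := (\sum_(0 <= D < n) box_count q d D)%N.

(** Slice by one exponent [j]; for [j >= n] the truncated difference makes the slice empty. *)
Lemma box_sum_rec d n :
  box_sum d.+1 n = (\sum_(0 <= j < q) box_sum d (n - j))%N.
Proof.
rewrite /box_sum; elim: n => [|n IH].
  by rewrite big_geq // big1 // => j _; rewrite sub0n big_geq.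
rewrite big_nat_recr //= IH.
have -> : (\sum_(0 <= j < minn q n.+1) box_count q d (n - j) =
  \sum_(0 <= j < q) if (j < n.+1)%N then box_count q d (n - j) else 0)%N.
  rewrite -big_mkcond /= [RHS]big_mkcond /= -[RHS]big_mkcond /=.
  rewrite (big_nat_widen _ _ q) ?geq_minl //= big_nat_cond [RHS]big_nat_cond.
  by apply: eq_bigl => j; rewrite leq_min; case: (j < q)%N; rewrite ?andbF ?andbT.
rewrite -big_split /=; apply: eq_bigr => j _; case: ltnP => jn.
  by rewrite subSn // big_nat_recr.
have -> : (n.+1 - j = 0)%N by lia.
have -> : (n - j = 0)%N by lia.
by rewrite addn0.
Qed.

Lemma box_sum0 n : box_sum 0 n = (0 < n)%N.
Proof.
case: n => [|n]; first by rewrite /box_sum big_geq.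
rewrite /box_sum big_nat_recl //= big1 // => i _.
Qed.

Lemma box_sum_total d n : (d * q < n)%N -> box_sum d n = (q ^ d)%N.
Proof.
elim: d n => [|d IH] n dn; first by rewrite box_sum0 (leq_ltn_trans _ dn).
rewrite box_sum_rec big_nat (eq_bigr (fun=> (q ^ d)%N)).
  by rewrite -big_nat big_const_nat subn0 iter_addn_0 mulnC expnS.
by move=> j /andP[_ jq]; apply: IH; lia.
Qed.

Lemma box_sum_ge d n t : (t <= q)%N -> (d * t < n)%N -> (t ^ d <= box_sum d n)%N.
Proof.
move=> tq; elim: d n => [|d IH] n dn; first by rewrite box_sum0 (leq_ltn_trans _ dn).
rewrite box_sum_rec (big_cat_nat _ (n := t)) //=; apply: leq_trans (leq_addr _ _).
have -> : (t ^ d.+1 = \sum_(0 <= j < t) t ^ d)%N.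
  by rewrite big_const_nat subn0 iter_addn_0 mulnC expnS.
rewrite !big_nat; apply: leq_sum => j /andP[_ jt]; apply: IH; lia.
Qed.

(* The number of exponents in [d] variables of total degree less than [m]. *)
Fixpoint simplex_count (d m : nat) : nat :=
  if d is d'.+1 then \sum_(0 <= l < m) simplex_count d' l.+1 else (0 < m)%N.

Lemma simplex_count0 d : simplex_count d 0 = 0%N.
Proof. by case: d => //= d; rewrite big_geq. Qed.

Lemma simplex_countS d m :
  simplex_count d.+1 m.+1 = (simplex_count d.+1 m + simplex_count d m.+1)%N.
Proof. by rewrite /= big_nat_recr. Qed.

(** A point of the simplex has first exponent below [q], or lowering that exponent by [q] gives a
    point of the simplex of size [m - q]. *)
Lemma simplex_count_sum d m :
  (\sum_(0 <= j < q) simplex_count d (m - j) + simplex_count d.+1 (m - q) =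
   simplex_count d.+1 m)%N.
Proof.
elim: q => [|r IH]; first by rewrite big_geq // subn0.
rewrite big_nat_recr // -[RHS]IH -addnA; congr addn.
case: (posnP (m - r)) => H; first by rewrite subnS H !simplex_count0.
rewrite subnS -(prednK H) [LHS]addnC; exact/esym/simplex_countS.
Qed.

(** The count is the binomial coefficient [C(m + d - 1, d)]. The case [d = m = 0] is excluded: there
    the empty product is 1 but the count is 0. *)
Lemma simplex_count_fact d m : (0 < d)%N ->
  (simplex_count d m * d`! = \prod_(0 <= i < d) (m + i))%N.
Proof.
have H e n : (0 < n)%N -> (simplex_count e n * e`! = \prod_(0 <= i < e) (n + i))%N.
  elim: e n => [|e IH] n n0; first by rewrite big_geq //= n0.
  elim: n n0 => // n IHn _; rewrite simplex_countS mulnDl.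
  have -> : (simplex_count e.+1 n * e.+1`! = \prod_(0 <= i < e.+1) (n + i))%N.
    case: (posnP n) => [->|/IHn//].
    by rewrite simplex_count0 big_nat_recl //= addn0 mul0n.
  rewrite factS [(e.+1 * _)%N]mulnC mulnA (IH n.+1) //.
  rewrite big_nat_recl // big_nat_recr //= addn0.
  rewrite (eq_bigr (fun i => n.+1 + i)%N); last by move=> i _; rewrite addnS.
  by rewrite mulnC -mulnDr; congr muln; lia.
move=> d0; case: (posnP m) => [->|/H//].
by rewrite simplex_count0; case: d d0 => // d _; rewrite big_nat_recl //= mul0n.
Qed.

(* Inclusion-exclusion over the coordinates that are at least [q]. *)
Lemma box_sum_simplex (F : comNzRingType) d n : (box_sum d n)%:R =
  \sum_(0 <= i < d.+1)
    (-1) ^+ i * ('C(d, i))%:R * (simplex_count d (n - i * q))%:R :> F.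
Proof.
elim: d n => [|d IH] n.
  by rewrite big_nat1 box_sum0 expr0 !mul1r mul0n subn0.
rewrite box_sum_rec natr_sum (eq_bigr _ (fun j _ => IH (n - j)%N)) exchange_big /=.
(* Summing over the new coordinate turns a term into a difference of two terms one dimension higher;
   Pascal's rule then recombines them. *)
have E i : \sum_(0 <= j < q) (-1) ^+ i * ('C(d, i))%:R * (simplex_count d (n - j - i * q))%:R
  = (-1) ^+ i * ('C(d, i))%:R * (simplex_count d.+1 (n - i * q))%:R
    + (-1) ^+ i.+1 * ('C(d, i))%:R * (simplex_count d.+1 (n - i.+1 * q))%:R :> F.
  rewrite -mulr_sumr exprS mulN1r !mulNr -mulrBr; congr (_ * _).
  have -> : (n - i.+1 * q = n - i * q - q)%N by rewrite mulSn addnC subnDA.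
  rewrite -(simplex_count_sum d (n - i * q)) natrD addrK natr_sum.
  by apply: eq_bigr => j _; rewrite subnAC.
rewrite (eq_bigr _ (fun i _ => E i)) big_split /=.
rewrite [RHS]big_nat_recl // [X in X + _ = _]big_nat_recl //.
rewrite !bin0 -addrA; congr (_ + _).
rewrite [in RHS](eq_bigr (fun i => (-1) ^+ i.+1 * ('C(d, i.+1))%:R *
   (simplex_count d.+1 (n - i.+1 * q))%:R + (-1) ^+ i.+1 * ('C(d, i))%:R *
   (simplex_count d.+1 (n - i.+1 * q))%:R)); last first.
  by move=> i _; rewrite binS natrD mulrDr mulrDl.
rewrite big_split /=; congr (_ + _).
by rewrite [RHS]big_nat_recr //= bin_small // mulr0 mul0r addr0.
Qed.

End Counting.

(** * Asymptotics of the box count *)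

Section Asymptotics.
Variables (F : realType) (p d c : nat) (s : F).
Hypothesis p1 : (1 < p)%N.
Hypothesis d0 : (0 < d)%N.
Hypothesis s0 : 0 < s.

Definition ceil_nat (q : nat) : nat := `|Num.ceil (s * q%:R)|%N.

Lemma ceil_nat_ge q : s * q%:R <= (ceil_nat q)%:R.
Proof.
rewrite /ceil_nat natr_absz ger0_norm; first exact: ceil_ge.
rewrite ceil_ge0; apply: (@lt_le_trans _ _ 0); first by rewrite ltrN10.
by rewrite mulr_ge0 // ltW.
Qed.

Lemma ceil_nat_lt q : (ceil_nat q)%:R < s * q%:R + 1.
Proof.
rewrite /ceil_nat natr_absz ger0_norm.
  by have := ceilB1_lt (s * q%:R); rewrite rmorphB /= ltrBlDr.
rewrite ceil_ge0; apply: (@lt_le_trans _ _ 0); first by rewrite ltrN10.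
by rewrite mulr_ge0 // ltW.
Qed.

Let Q (e : nat) : F := ((p ^ e)%:R)^-1.

Lemma expn_gt0F e : 0 < (p ^ e)%:R :> F.
Proof. by rewrite ltr0n expn_gt0 ltnW. Qed.

Lemma cvg_invq : Q e @[e --> \oo] --> (0 : F).
Proof.
have -> : Q = (fun e => (p%:R^-1) ^+ e).
  by apply/funext => e; rewrite /Q natrX exprVn.
apply: cvg_expr; rewrite ger0_norm ?invr_ge0 // invf_lt1 ?ltr1n //.
by rewrite ltr0n ltnW.
Qed.

(** Rounding up and subtracting [c] changes the quotient by at most [(c + 1) / q], and truncated
    subtraction becomes the maximum with 0. *)
Lemma cvg_trunc_sub i : (ceil_nat (p ^ e) - c - i * p ^ e)%:R * Q e @[e --> \oo]
  --> Num.max (s - i%:R) 0.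
Proof.
set a := Num.max _ _.
have a_cvg (b : F) : a + b * Q e @[e --> \oo] --> a.
  rewrite -[X in _ --> X]addr0; apply: cvgD; first exact: cvg_cst.
  rewrite -[X in _ --> X](mulr0 b); apply: cvgM; first exact: cvg_cst.
  exact: cvg_invq.
apply: (squeeze_cvgr _ (a_cvg (- (c.+1)%:R)) (a_cvg 1)).
apply: nearW => e; set q := (p ^ e)%N.
have q0 : 0 < q%:R :> F by apply: expn_gt0F.
have aq b : a + b * Q e = (a * q%:R + b) * Q e.
  by rewrite mulrDl -mulrA /Q divff ?mulr1 // gt_eqF.
rewrite !aq !ler_pM2r ?invr_gt0 //.
have H1 := ceil_nat_ge q; have H2 := ceil_nat_lt q.
set N := ceil_nat q in H1 H2 *.
have a0 : 0 <= a by rewrite /a le_max lexx orbT.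
have as_ : s - i%:R <= a by rewrite /a le_max lexx.
apply/andP; split.
- rewrite -natr1 opprD /a; have [si|si] := leP (s - i%:R) 0.
    rewrite mul0r add0r; apply: (@le_trans _ _ 0) => //.
  have : N%:R - c%:R - i%:R * q%:R <= (N - c - i * q)%:R :> F.
    rewrite !lerBlDr -natrM -!natrD ler_nat; lia.
  nra.
- have [H|H] := leqP (N - c) (i * q).
    by move: H; rewrite -subn_eq0 => /eqP ->; apply: addr_ge0 => //; apply: mulr_ge0 => //; exact: ltW.
  have : (N - c - i * q)%:R + i%:R * q%:R <= N%:R :> F.
    rewrite -natrM -natrD ler_nat; lia.
  have : (s - i%:R) * q%:R <= a * q%:R by rewrite ler_pM2r.
  nra.
Qed.

Lemma cvg_simplex_count i :
  (simplex_count d (ceil_nat (p ^ e) - c - i * p ^ e))%:R * Q e ^+ d @[e --> \oo]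
  --> Num.max (s - i%:R) 0 ^+ d / d`!%:R.
Proof.
have fd : (d`!)%:R != 0 :> F by rewrite pnatr_eq0 -lt0n fact_gt0.
under eq_cvg => e.
  rewrite (_ : _ * _ = (\prod_(j < d) ((ceil_nat (p ^ e) - c - i * p ^ e)%:R * Q e
     + j%:R * Q e)) / d`!%:R); last first.
    apply: (mulIf fd); rewrite divfK // mulrAC -natrM simplex_count_fact //.
    rewrite big_mkord natr_prod -[d in _ ^+ d]card_ord -prodr_const -big_split /=.
    by apply: eq_bigr => j _; rewrite natrD mulrDl.
  over.
apply: cvgM; last exact: cvg_cst.
rewrite -[d in _ ^+ d]card_ord -prodr_const.
apply: cvg_big => [|j _]; first exact: mul_continuous.
rewrite -[X in _ --> X]addr0; apply: cvgD; first exact: cvg_trunc_sub.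
rewrite -[X in _ --> X](mulr0 (j%:R : F)); apply: cvgM; first exact: cvg_cst.
exact: cvg_invq.
Qed.

Lemma cvg_box_sum :
  (box_sum (p ^ e) d (ceil_nat (p ^ e) - c))%:R * Q e ^+ d @[e --> \oo]
  --> H_s s d.
Proof.
(* The two sums end at [floor s] and at [d]. Terms beyond [d] have binomial coefficient 0 and terms
   beyond [floor s] have maximum 0, so both equal the sum up to the larger end. *)
have -> : H_s s d = \sum_(0 <= i < d.+1) (-1) ^+ i * ('C(d, i))%:R *
    (Num.max (s - i%:R) 0 ^+ d / d`!%:R).
  pose T i := (-1) ^+ i * ('C(d, i))%:R * (Num.max (s - i%:R) 0 ^+ d / d`!%:R).
  have T0 i : (d < i)%N || (Num.truncn s < i)%N -> T i = 0.
    case/orP => H; rewrite /T; first by rewrite bin_small // mulr0 mul0r.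
    rewrite max_r; first by rewrite expr0n gtn_eqF // mul0r mulr0.
    rewrite subr_le0; apply: ltW; apply: lt_le_trans (truncnS_gt s) _.
    by rewrite ler_nat.
  pose N := maxn d.+1 (Num.truncn s).+1.
  have -> : \sum_(0 <= i < d.+1) T i = \sum_(0 <= i < N) T i.
    rewrite [RHS](big_cat_nat _ (n := d.+1)) ?leq_maxl //=.
    rewrite -[LHS]addr0; congr (_ + _); rewrite big_nat big1 //.
    by move=> i /andP[di _]; apply: T0; rewrite di.
  rewrite [RHS](big_cat_nat _ (n := (Num.truncn s).+1)) ?leq_maxr //=.
  rewrite -[LHS]addr0; congr (_ + _); last first.
    by rewrite big_nat big1 // => i /andP[di _]; apply: T0; rewrite di orbT.
  rewrite /H_s; apply: eq_big_nat => i /andP[_ is_]; rewrite /T max_l.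
    by rewrite [RHS]mulrC [RHS]mulrCA; field; rewrite pnatr_eq0 -lt0n fact_gt0.
  rewrite subr_ge0; apply: (@le_trans _ _ (Num.truncn s)%:R); first by rewrite ler_nat.
  by rewrite truncn_le ltW.
under eq_cvg => e.
  rewrite (box_sum_simplex _ F) mulr_suml.
  under eq_bigr => i _ do rewrite -[_ * Q e ^+ d]mulrA.
  over.
apply: cvg_big => [|i _]; first exact: add_continuous.
by apply: cvgMl_tmp; exact: cvg_simplex_count.
Qed.

(** A cube bounds the limit from below: since [b <= 1] and [d * b <= s / 2], the points with
    exponents below [b * q], rounded down, are all counted once [q] is large. *)
Lemma H_s_gt0 : 0 < H_s s d.
Proof.
pose b : F := Num.min 1 (s / (2 * d%:R)).
have dF : 0 < d%:R :> F by rewrite ltr0n.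
have b0 : 0 < b by rewrite lt_min ltr01 divr_gt0 // mulr_gt0.
have b1 : b <= 1 by rewrite ge_min lexx.
have bs : d%:R * b <= s / 2.
  have : b <= s / (2 * d%:R) by rewrite ge_min lexx orbT.
  rewrite ler_pdivlMr ?mulr_gt0 //; nra.
apply: (@lt_le_trans _ _ ((b / 2) ^+ d)); first by rewrite exprn_gt0 // divr_gt0.
apply: cvgr_to_ge cvg_box_sum _.
(* These bounds on [1 / q] give [t >= b * q / 2] and [c < s * q / 2]. *)
have : \forall e \near \oo, Q e < Num.min (b / 2) (s / (2 * c.+1%:R)).
  by apply: cvgr_lt cvg_invq _ _; rewrite lt_min !divr_gt0 ?mulr_gt0.
apply: filterS => e; rewrite lt_min => /andP[Qb Qs].
set q := (p ^ e)%N in Qb Qs *; have q0 : 0 < q%:R :> F by apply: expn_gt0F.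
have Qq : Q e * q%:R = 1 by rewrite /Q mulVf // gt_eqF.
have Q0 : 0 < Q e by rewrite /Q invr_gt0.
have qb : 1 < (b / 2) * q%:R.
  have : Q e * q%:R < b / 2 * q%:R by rewrite ltr_pM2r.
  by rewrite Qq.
have qs : c.+1%:R * 2 < s * q%:R.
  move: Qs; rewrite ltr_pdivlMr ?mulr_gt0 // => Qs.
  have : Q e * (2 * c.+1%:R) * q%:R < s * q%:R by rewrite ltr_pM2r.
  by rewrite mulrAC Qq mul1r mulrC.
pose t := Num.truncn (b * q%:R).
have bq0 : 0 <= b * q%:R by rewrite mulr_ge0 // ltW.
have tb : t%:R <= b * q%:R by rewrite truncn_le.
have bt : b * q%:R < t.+1%:R by apply: truncnS_gt.
have tq : (t <= q)%N.
  rewrite -(ler_nat F); apply: le_trans tb _; by rewrite ler_piMl // ltW.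
have dt : (d * t < ceil_nat q - c)%N.
  have H1 := ceil_nat_ge q.
  rewrite ltn_subRL addnC.
  rewrite -(ltr_nat F); apply: lt_le_trans H1.
  rewrite natrD natrM.
  have : d%:R * t%:R <= d%:R * (b * q%:R) by rewrite ler_pM2l.
  rewrite mulrA -natr1 in qs *; move=> ?.
  have : d%:R * b * q%:R <= s / 2 * q%:R by rewrite ler_pM2r.
  nra.
have := box_sum_ge tq dt; rewrite -(ler_nat F) natrX => H.
apply: (@le_trans _ _ ((t%:R * Q e) ^+ d)); last first.
  by rewrite exprMn ler_pM2r // exprn_gt0.
apply: lerXn2r; rewrite ?nnegrE.
- by rewrite divr_ge0 // ltW.
- by rewrite mulr_ge0 // ltW.
have -> : b / 2 = (b / 2 * q%:R) * Q e by rewrite -mulrA [q%:R * _]mulrC Qq mulr1.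
rewrite ler_pM2r //; move: bt; rewrite -natr1; nra.
Qed.

End Asymptotics.

(** * Primes and dimension *)

Section MaxNat.
Variable P : set nat.

(** A positive value cannot be the default [0], so the maximum is attained. *)
Lemma max_nat_gt0 : (0 < max_nat P)%N ->
  P (max_nat P) /\ forall n, P n -> (n <= max_nat P)%N.
Proof. by rewrite /max_nat; case: xgetP. Qed.

Lemma max_nat_eq n : P n -> (forall i, P i -> (i <= n)%N) -> max_nat P = n.
Proof.
move=> Pn Hn; apply: xget_unique => //= i [Pi Hi].
by apply/eqP; rewrite eqn_leq Hn // Hi.
Qed.

End MaxNat.

Section Primes.
Variable R : comNzRingType.
Implicit Types (I J P O : set R) (a b u v x y : R) (xs s : seq R).

Lemma idealr_closedP I : idealr_closed [in I] <-> ideal I /\ ~ I 1.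
Proof.
split=> [[I0 I1 H]|[idI I1]].
  split; last by move=> h; move/negP: I1; apply; rewrite inE.
  by split=> // a x y; apply: H.
split; first by rewrite inE; apply: ideal0.
  by apply/negP; rewrite inE.
move=> a x y; rewrite !inE => Ix Iy; apply: idealD => //; exact: ideal_mulr.
Qed.

Lemma prime_idealP P : prime_ideal P <->
  [/\ ideal P, ~ P 1 & forall u v, P (u * v) -> P u \/ P v].
Proof.
split=> [[/idealr_closedP [idP P1] H]|[idP P1 H]].
  split=> // u v; have := H u v; rewrite !inE => {}H Puv.
  by have /orP[] := H Puv; rewrite inE; [left|right].
split; first exact/idealr_closedP.
by move=> u v; rewrite inE => /H [] h; apply/orP; [left|right]; rewrite inE.
Qed.

Lemma exists_maximal_avoiding I (W : set R) : ideal I ->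
  (forall x, I x -> ~ W x) ->
  exists P, [/\ ideal P, I `<=` P, forall x, P x -> ~ W x &
    forall J, ideal J -> P `<=` J -> (forall x, J x -> ~ W x) -> J = P].
Proof.
move=> idI IW.
(* Stating the property for the union of [I] and [X] covers the empty chain in Zorn's lemma, whose
   union is empty. *)
pose Q (X : set R) := ideal (I `|` X) /\ forall x, (I `|` X) x -> ~ W x.
have [A [[idA AW] Amax]] : exists A, Q A /\ forall B, A `<` B -> ~ Q B.
  apply: Zorn_bigcup => F FQ Ftot.
  have [->|/set0P [X0 FX0]] := eqVneq F set0.
    by rewrite bigcup_set0 /Q setU0.
  have lift x : (I `|` \bigcup_(X in F) X) x -> exists2 X, F X & (I `|` X) x.
    by move=> [Ix|[X FX Xx]]; [exists X0 => //; left|exists X => //; right].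
  have unlift X x : F X -> (I `|` X) x -> (I `|` \bigcup_(X in F) X) x.
    by move=> FX [Ix|Xx]; [left|right; exists X].
  split; last by move=> x /lift [X /FQ [_]]; apply.
  apply/idealP; split.
  - by left; apply: ideal0.
  - move=> x y /lift [X FX Xx] /lift [Y FY Yy].
    have [XY|YX] := Ftot X Y FX FY.
      apply: (unlift Y) => //; have [idY _] := FQ Y FY; apply: idealD => //.
      by case: Xx => [Ix|/XY Yx]; [left|right].
    apply: (unlift X) => //; have [idX _] := FQ X FX; apply: idealD => //.
    by case: Yy => [Iy|/YX Xy]; [left|right].
  - move=> a x /lift [X FX Xx]; apply: (unlift X) => //.
    by have [idX _] := FQ X FX; apply: ideal_mulr.
exists (I `|` A); split=> //.
move=> J idJ PJ JW; apply/seteqP; split=> // x Jx.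
apply: contrapT => nPx; apply: (Amax J).
  by split=> [y Ay|JA]; [apply: PJ; right|apply: nPx; right; apply: JA].
have IJ : I `|` J = J by apply/setUidPr => y Iy; apply: PJ; left.
by rewrite /Q IJ.
Qed.

(** If [u] and [v] are outside a maximal such [P], both [P + (u)] and [P + (v)] meet [W]; were
    [u * v] in [P], the product of the two elements found would lie in [P] and [W]. *)
Lemma exists_prime I (W : set R) : ideal I -> W 1 ->
  (forall x y, W x -> W y -> W (x * y)) -> (forall x, I x -> ~ W x) ->
  exists P, [/\ prime_ideal P, I `<=` P & forall x, P x -> ~ W x].
Proof.
move=> idI W1 WM IW; have [P [idP IP PW Pmax]] := exists_maximal_avoiding idI IW.
exists P; split=> //; apply/prime_idealP; split=> // [P1|u v Puv].
  exact: PW P1 W1.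
apply: contrapT => /not_orP [nPu nPv].
have meets a : ~ P a -> exists2 x, adjoin P a x & W x.
  move=> nPa; apply: contrapT => H; apply: nPa.
  rewrite -(Pmax (adjoin P a)); first exact: mem_adjoin1.
  - exact: ideal_adjoin.
  - exact: sub_adjoin.
  - by move=> x Px Wx; apply: H; exists x.
have [x [r Px] Wx] := meets _ nPu; have [y [t Py] Wy] := meets _ nPv.
apply: (PW (x * y)); last exact: WM.
have -> : x * y = (x - r * u) * y + r * u * (y - t * v) + r * t * (u * v) by ring.
by do ?apply: idealD => //; [apply: ideal_mull|apply: ideal_mulr|apply: ideal_mulr].
Qed.

(** A nonunit lies in an ideal maximal among those avoiding [1], and this ideal must be [m]. *)
Lemma local_units (m : set R) : maximal_ideal m ->
  (forall m', maximal_ideal m' -> m' = m) -> forall a, ~ m a -> exists b, b * a = 1.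
Proof.
move=> mm muniq a nma; apply: contrapT => na.
have id0 := @ideal_zero R; have ida := ideal_adjoin a id0.
have [x|P [idP IP PW Pmax]] := @exists_maximal_avoiding _ [set 1] ida.
  move=> [r /= xr] x1; apply: na; exists r.
  by apply/esym/eqP; rewrite -subr_eq0 -{1}x1 xr.
apply: nma; rewrite -(muniq P); first exact/IP/mem_adjoin1.
split; first by apply/idealr_closedP; split=> // /PW; apply.
move=> J /idealr_closedP [idJ J1] PJ; apply: Pmax => // x Jx x1.
by apply: J1; rewrite -x1.
Qed.

Definition prime_chain_below (n : nat) P : Prop :=
  exists c : nat -> set R, [/\ forall i, (i <= n)%N -> prime_ideal (c i),
    forall i, (i < n)%N -> c i `<` c i.+1 & c n = P].

Lemma prime_chain_extend n P Q : prime_chain_below n P -> prime_ideal Q ->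
  P `<` Q -> prime_chain_below n.+1 Q.
Proof.
move=> [c [c1 c2 cn]] pQ PQ.
exists (fun i => if (i <= n)%N then c i else Q); split.
- by move=> i _; case: ifP => // /c1.
- move=> i; rewrite ltnS => i_n; rewrite i_n; case: ltnP => // ni; first exact: c2.
  by have -> : i = n by [apply/eqP; rewrite eqn_leq i_n ni]; rewrite cn.
- by rewrite ltnn.
Qed.

(* A regular element [a] modulo [O] lies in no prime minimal over [O]: localize
   away from [P] and invert [a]. *)
Lemma exists_smaller_prime O a P : ideal O -> nzd O a -> prime_ideal P ->
  O `<=` P -> P a -> exists Q, [/\ prime_ideal Q, O `<=` Q & Q `<` P].
Proof.
move=> idO Ha /prime_idealP [idP P1 PM] OP Pa.
have [||x Ox [n [u [nPu xE]]]|Q [pQ OQ QW]] := @exists_prime O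
    [set x | exists n u, ~ P u /\ x = u * a ^+ n] idO.
- by exists 0%N, 1; rewrite mul1r.
- move=> _ _ [n [u [Pu ->]]] [n' [u' [Pu' ->]]]; exists (n + n')%N, (u * u').
  split; first by move=> /PM [].
  by rewrite mulrACA -exprD.
- apply: nPu; apply: OP.
  by apply: (nzd_exp (n := n) Ha); rewrite -xE.
exists Q; split=> //; split.
  move=> x Qx; apply: contrapT => nPx; apply: (QW x) => //.
  by exists 0%N, x; rewrite mulr1.
move=> PQ; apply: (QW a (PQ _ Pa)).
by exists 1%N, 1; rewrite mul1r expr1.
Qed.

(** From the last element of the sequence to the first, [exists_smaller_prime] descends by one
    prime. *)
Lemma regular_prime_chain xs P : regular_seq xs -> prime_ideal P ->
  gen [set 0] xs `<=` P -> prime_chain_below (size xs) P.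
Proof.
move=> [H _]; have id0 := @ideal_zero R.
suff Hi i Q : (i <= size xs)%N -> prime_ideal Q -> gen [set 0] (take i xs) `<=` Q ->
    prime_chain_below i Q.
  by move=> pP; rewrite -{1}(take_size xs); apply: Hi.
elim: i Q => [|i IH] Q ix pQ gQ; first by exists (fun=> Q).
have idt := ideal_gen (take i xs) id0.
have gE : gen [set 0] (take i.+1 xs) = adjoin (gen [set 0] (take i xs)) xs`_i.
  rewrite (take_nth 0 ix) -[adjoin _ _]/(gen [set 0] (xs`_i :: take i xs)).
  by apply: perm_gen => //; rewrite perm_rcons.
have Hn : nzd (gen [set 0] (take i xs)) xs`_i.
  by move=> r; rewrite -gen_span mulrC; apply: H.
rewrite gE in gQ.
have [Q' [pQ' OQ' QQ']] := exists_smaller_prime idt Hn pQ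
  (subset_trans (sub_adjoin _) gQ) (gQ _ (mem_adjoin1 _ idt)).
by apply: prime_chain_extend QQ' => //; apply: IH => //; apply: ltnW.
Qed.

(** Otherwise a prime containing [xs] and no power of [a] lies strictly inside [m], and the chain of
    length [size xs] below it extends to [m]. *)
Lemma regular_primary (m : set R) xs : prime_ideal m ->
  (forall a, ~ m a -> exists b, b * a = 1) ->
  regular_seq xs -> ~ strict_chain (@prime_ideal R) (size xs).+1 ->
  forall a, m a -> exists n, gen [set 0] xs (a ^+ n).
Proof.
move=> pm munit reg nchain a ma; apply: contrapT => na.
have id0 := @ideal_zero R; have idx := ideal_gen xs id0.
have [||x gx [n xn]|P [pP gP PW]] := @exists_prime _ [set x | exists n, x = a ^+ n] idx.
- by exists 0%N.
- by move=> _ _ [i ->] [j ->]; exists (i + j)%N; rewrite exprD.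
- by apply: na; exists n; rewrite -xn.
have Pm : P `<` m.
  split; last by move=> mP; apply: (PW a (mP _ ma)); exists 1%N; rewrite expr1.
  move=> x Px; apply: contrapT => /munit [b bx].
  have /prime_idealP [idP P1 _] := pP; apply: P1; rewrite -bx; exact: ideal_mulr.
have [c [c1 c2 _]] := prime_chain_extend (regular_prime_chain reg pP gP) pm Pm.
by apply: nchain; exists c.
Qed.

End Primes.

(** * Primes and ideals under ring homomorphisms *)

Section SurjectivePrimes.
Variables (A B : comNzRingType) (f : {rmorphism A -> B}).
Hypothesis f_surj : forall b, exists a, f a = b.

Lemma prime_preimage (P : set B) : prime_ideal P -> prime_ideal (f @^-1` P).
Proof.
move=> /prime_idealP [idP P1 PM]; apply/prime_idealP; split.
- exact: ideal_preimage.
- by rewrite /preimage /= rmorph1.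
- by move=> u v; rewrite /preimage /= rmorphM; apply: PM.
Qed.

Lemma strict_chain_preimage (C : set (set B)) (D : set (set A)) n :
  (forall P, C P -> D (f @^-1` P)) -> strict_chain C n -> strict_chain D n.
Proof.
move=> CD [c [c1 c2]]; exists (fun i => f @^-1` c i); split=> i i_n.
  exact/CD/c1.
have [s1 s2] := c2 _ i_n; split=> [a|H]; first exact: s1.
apply: s2 => b; have [a <-] := f_surj b; exact: H.
Qed.

Lemma prime_image (P : set A) : prime_ideal P -> (forall a, f a = 0 -> P a) ->
  prime_ideal (f @` P) /\ forall a, (f @` P) (f a) -> P a.
Proof.
move=> /prime_idealP [idP P1 PM] kerP.
have back a : (f @` P) (f a) -> P a.
  move=> [b Pb ba]; rewrite -(subrK b a); apply: idealD => //.
  by apply: kerP; rewrite rmorphB ba subrr.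
split=> //; apply/prime_idealP; split.
- apply/idealP; split.
  + by exists 0; [exact: ideal0|rewrite rmorph0].
  + by move=> _ _ [a Pa <-] [b Pb <-]; exists (a + b); [exact: idealD|rewrite rmorphD].
  + move=> b _ [a Pa <-]; have [c <-] := f_surj b.
    by exists (c * a); [exact: ideal_mulr|rewrite rmorphM].
- by rewrite -(rmorph1 f) => /back.
- move=> u v; have [a <-] := f_surj u; have [b <-] := f_surj v.
  by rewrite -rmorphM => /back /PM [] h; [left; exists a|right; exists b].
Qed.

Lemma strict_chain_image (c : nat -> set A) n :
  (forall i, (i <= n)%N -> prime_ideal (c i)) ->
  (forall i, (i < n)%N -> c i `<` c i.+1) ->
  (forall a, f a = 0 -> c 0%N a) -> strict_chain (@prime_ideal B) n.
Proof.
move=> c1 c2 ker0.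
have ker i : (i <= n)%N -> forall a, f a = 0 -> c i a.
  elim: i => [|i IH] i_n // a fa; have [s _] := c2 _ i_n.
  by apply: s; apply: IH => //; apply: ltnW.
exists (fun i => f @` c i); split=> i i_n.
  by have [] := prime_image (c1 _ i_n) (ker _ i_n).
have [s1 s2] := c2 _ i_n; split; first exact: image_subset.
move=> H; apply: s2 => a ca.
have [_ back] := prime_image (c1 _ (ltnW i_n)) (ker _ (ltnW i_n)).
by apply: back; apply: H; exists a.
Qed.

End SurjectivePrimes.

Lemma rmorph_ideal_pow (A B : comNzRingType) (f : {rmorphism A -> B})
    (I : set A) (J : set B) n : (forall a, I a -> J (f a)) ->
  forall a, ideal_pow I n a -> ideal_pow J n (f a).
Proof.
move=> IJ; elim: n => // n IH.
suff : ideal_pow I n.+1 `<=` f @^-1` (ideal_pow J n.+1) by [].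
apply: ideal_powS_sub; first exact/ideal_preimage/ideal_ideal_pow.
move=> a b /IJ Ja /IH Jb; rewrite /preimage /= rmorphM; exact: mem_ideal_powS.
Qed.

Lemma rmorph_frobenius_pow (A B : comNzRingType) (f : {rmorphism A -> B})
    (I : set A) (J : set B) q : (forall a, I a -> J (f a)) ->
  forall a, frobenius_pow I q a -> frobenius_pow J q (f a).
Proof.
move=> IJ.
suff : frobenius_pow I q `<=` f @^-1` (frobenius_pow J q) by [].
apply: ideal_span_sub; first exact/ideal_preimage/ideal_span_ideal.
by move=> _ [a /IJ Ja <-]; rewrite /preimage /= rmorphXn; apply: sub_ideal_span; exists (f a).
Qed.

Lemma rmorph_ideal_add (A B : comNzRingType) (f : {rmorphism A -> B})
    (I I' : set A) (J J' : set B) :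
  (forall a, I a -> J (f a)) -> (forall a, I' a -> J' (f a)) ->
  forall a, ideal_add I I' a -> ideal_add J J' (f a).
Proof.
move=> IJ IJ' _ [a /IJ Ja [b /IJ' Jb <-]].
by exists (f a) => //; exists (f b); rewrite // rmorphD.
Qed.

Lemma pchar_exprD (A : comNzRingType) (p : nat) : p \in [pchar A] ->
  forall e (x y : A), (x + y) ^+ (p ^ e) = x ^+ (p ^ e) + y ^+ (p ^ e).
Proof.
move=> pA e x y; apply: exprDn_pchar; rewrite pnatX pnatE ?pA //.
by have /andP[] := pA.
Qed.

(** * The bound for a Cohen-Macaulay local ring *)

Section LocalCohenMacaulay.
Variables (R : comNzRingType) (m : set R) (k : fieldType).
Hypothesis hR : local_ring m k.
Let id0 := @ideal_zero R.

Lemma local_ring_ideal : ideal m.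
Proof. by case: hR => _ [/idealr_closedP []]. Qed.

Lemma local_ring_unit a : ~ m a -> exists b, b * a = 1.
Proof. by case: hR => _ mm mu _; apply: (local_units mm mu). Qed.

Lemma local_ring_prime : prime_ideal m.
Proof.
have idm := local_ring_ideal; have [_ [/idealr_closedP [_ m1] _] _ _] := hR.
apply/prime_idealP; split=> // u v muv.
apply: contrapT => /not_orP [nu nv].
exact: (local_nmemM idm local_ring_unit nu nv).
Qed.

Lemma local_ring_generators : exists zs : seq R, m = gen [set 0] zs.
Proof.
have [noeth _ _ _] := hR.
have [X /finite_seqP [zs ->] ->] := noeth _ local_ring_ideal.
by exists zs; apply: gen_span.
Qed.

Lemma cohen_macaulay_bound (p : nat) : p \in [pchar R] -> cohen_macaulay m ->
  (0 < krull_dim R)%N ->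
  exists c, forall e n l,
    len_le m [set: R]
      (ideal_add (ideal_pow m (n + c)) (frobenius_pow m (p ^ e))) l ->
    (box_sum (p ^ e) (krull_dim R) n <= l)%N.
Proof.
move=> pR cm dim0; set d := krull_dim R in dim0 *.
have idm := local_ring_ideal.
have p1 : (1 < p)%N by apply: prime_gt1; move: pR; rewrite inE => /andP[].
have [xs [szx xsm reg]] : exists xs : seq R,
    [/\ size xs = d, [set` xs] `<=` m & regular_seq xs].
  (* The depth equals the positive dimension, so it is attained by a regular sequence. *)
  by have [] := @max_nat_gt0 _ (eq_ind_r (fun n => (0 < n)%N) dim0 cm); rewrite -/(depth m) cm.
have nochain : ~ strict_chain (@prime_ideal R) (size xs).+1.
  have [_ H] := max_nat_gt0 dim0; move=> /H; rewrite szx.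
  by rewrite -/(krull_dim R) -/d ltnn.
have nilm := regular_primary local_ring_prime local_ring_unit reg nochain.
have [zs mE] := local_ring_generators.
have mzs z : z \in zs -> m z by rewrite mE; apply: mem_gen.
have idx := ideal_gen xs id0.
have [e He] : exists e, len_le m [set: R] (gen [set 0] xs) e.
  apply: (@len_le_ex _ m _ zs) => //.
    by rewrite {1}mE; apply: genS => _ ->; apply: ideal0.
  by move=> a /mzs /nilm.
have [_ _ _ [pi [_ mpi]]] := hR.
rewrite mpi in He mE xsm *.
set E := generic_ext pi; pose f := generic_embed pi.
pose M : set E := ext_ideal [set a | pi a = 0].
have idM : ideal M by apply: ideal_ext_ideal; apply: ideal_ker.
have ME : M = gen [set 0] [seq f z | z <- zs] by rewrite /M mE ext_ideal_gen.
have mM a : pi a = 0 -> M (f a).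
  by move=> pa; apply: embed_ext_ideal => //; apply: ideal_ker.
have good : good_params M [seq f x | x <- xs].
  split.
  - by move=> _ /mapP [x xxs ->]; apply: mM; apply: xsm.
  - apply: weakly_regular_quasi_regular => i; rewrite size_map => ix.
    rewrite (nth_map 0) // -map_take -ext_ideal_gen.
    apply: nzd_ext; first exact: ideal_gen.
    by move=> r; rewrite -gen_span mulrC; have [H _] := reg; apply: H.
  - exists e; apply: (len_le_ext idx He); first by apply: ideal_gen; apply: ideal_zero.
    by move=> a ga; rewrite -ext_ideal_gen; apply: embed_ext_ideal.
have [c Hc] := local_bound idM (@ext_ker1 _ _ pi) (@ext_ker_unit _ _ pi)
  (@generic_point_inj _ _ pi) (zs := [seq f z | z <- zs])
  (eq_ind _ (fun X => M `<=` X) (@subset_refl _ M) _ ME)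
  (fun z zz => eq_ind_r (fun X : set E => X z) (mem_gen (@ideal_zero E) zz) ME) good.
exists c => e' n l Hl.
have pE : p \in [pchar E] by apply: (rmorph_pchar f).
have q0 : (0 < p ^ e')%N by rewrite expn_gt0 ltnW.
have {Hl}Hl : len_le M [set: E]
    (ideal_add (ideal_pow M (n + c)) (frobenius_pow M (p ^ e'))) l.
  apply: len_le_ext Hl _ _ _.
  - apply: ideal_ideal_add; [exact: ideal_ideal_pow|exact: ideal_span_ideal].
  - apply: ideal_ideal_add; [exact: ideal_ideal_pow|exact: ideal_span_ideal].
  - apply: rmorph_ideal_add; first exact: rmorph_ideal_pow.
    exact: rmorph_frobenius_pow.
have := Hc _ _ _ q0 (pchar_exprD pE e') Hl; rewrite size_map szx.
(* The whole box has [q^d] points; those of degree at least [n] cancel. *)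
rewrite -(@box_sum_total (p ^ e') d (n + (d * p ^ e').+1)); last by lia.
by rewrite /box_sum (big_cat_nat _ (n := n)) ?leq_addr //= addnC leq_add2l.
Qed.

End LocalCohenMacaulay.

(** * The fiber product *)

Section QuotLength.
Variable F : realType.

Lemma len_ge_chain (B : comNzRingType) (I : set B) M : ideal I ->
  len_ge [set: B] I M -> strict_chain [set J | ideal J /\ I `<=` J] M.
Proof.
move=> + H; elim: H => {I M} [I|I J M idJ _ IJ nJI _ IH] idI.
  by exists (fun=> I); split=> // i _; split.
have [c [c1 c2]] := IH idJ.
exists (fun i => if i is i'.+1 then c i' else I); split=> [[|i]|[|i]] //= i_n.
- by split.
- by have [idc Jc] := c1 _ i_n; split=> //; apply: subset_trans Jc.
- have [idc Jc] := c1 0%N (leq0n _); split; first exact: subset_trans Jc.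
  by move=> cI; apply: nJI; apply: subset_trans cI.
- exact: c2 _ i_n.
Qed.

Lemma quot_length_ge (A B : comNzRingType) (f : {rmorphism A -> B})
    (L : set A) (I : set B) M : (forall b, exists a, f a = b) -> ideal I ->
  (forall a, L a -> I (f a)) -> len_ge [set: B] I M ->
  ((M%:R)%:E <= quot_length F (V := A^o) L)%E.
Proof.
move=> fs idI LI /(len_ge_chain idI) H; apply: ereal_sup_ubound.
exists M => //; apply: (strict_chain_preimage (f := f)) H => // J [idJ IJ].
split; first exact: ideal_preimage.
by move=> a /LI /IJ.
Qed.

(** Were the length below [N], all strict chains over [B] would be shorter than [N], and
    [len_le_bounded] would give a filtration that contradicts the hypothesis. *)
Lemma quot_length_ge_nat (A B : comNzRingType) (f : {rmorphism A -> B})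
    (m : set B) n (L : set A) (I : set B) N :
  (forall b, exists a, f a = b) -> ideal I ->
  (forall a, L a -> I (f a)) -> ideal_pow m n `<=` I ->
  (forall l, len_le m [set: B] I l -> (N <= l)%N) ->
  ((N%:R)%:E <= quot_length F (V := A^o) L)%E.
Proof.
move=> fs idI LI mI H.
have ge M : len_ge [set: B] I M -> ((M%:R)%:E <= quot_length F (V := A^o) L)%E.
  exact: quot_length_ge.
case: N H => [|N] H; first by apply: ge; apply: len_ge_nil.
rewrite leNgt; apply/negP => lt.
suff /H : len_le m [set: B] I N by rewrite ltnn.
apply: (len_le_bounded idI mI) => M /ge HM.
have := le_lt_trans HM lt; by rewrite lte_fin ltr_nat ltnS.
Qed.

End QuotLength.

(** * Projections and dimension of the fiber product *)

Section FiberProduct.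
Variables (R S T : comNzRingType).
Variables (epsR : {rmorphism R -> T}) (epsS : {rmorphism S -> T}).
Local Notation A := (fiber_product epsR epsS).

Definition fiber_fst (x : A) : R := (fiber_val x).1.
Definition fiber_snd (x : A) : S := (fiber_val x).2.

Let val_fiber : {rmorphism A -> (R * S)%type} := val.

Lemma fiber_fst_zmod : zmod_morphism fiber_fst.
Proof. by move=> x y; apply: (congr1 fst (rmorphB val_fiber x y)). Qed.

Lemma fiber_fst_monoid : monoid_morphism fiber_fst.
Proof.
split=> [|x y]; first exact: (congr1 fst (rmorph1 val_fiber)).
exact: (congr1 fst (rmorphM val_fiber x y)).
Qed.

Lemma fiber_snd_zmod : zmod_morphism fiber_snd.
Proof. by move=> x y; apply: (congr1 snd (rmorphB val_fiber x y)). Qed.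

Lemma fiber_snd_monoid : monoid_morphism fiber_snd.
Proof.
split=> [|x y]; first exact: (congr1 snd (rmorph1 val_fiber)).
exact: (congr1 snd (rmorphM val_fiber x y)).
Qed.

HB.instance Definition _ := GRing.isZmodMorphism.Build A R fiber_fst fiber_fst_zmod.
HB.instance Definition _ := GRing.isMonoidMorphism.Build A R fiber_fst fiber_fst_monoid.
HB.instance Definition _ := GRing.isZmodMorphism.Build A S fiber_snd fiber_snd_zmod.
HB.instance Definition _ := GRing.isMonoidMorphism.Build A S fiber_snd fiber_snd_monoid.

Hypothesis surjR : set_surj [set: R] [set: T] epsR.
Hypothesis surjS : set_surj [set: S] [set: T] epsS.

Lemma fiber_fst_surj r : exists x, fiber_fst x = r.
Proof.
have [s _ sr] := surjS (I : [set: T] (epsR r)).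
have rs : (r, s) \in fiber_pred epsR epsS by rewrite inE /= sr.
by exists (FiberProduct rs).
Qed.

Lemma fiber_snd_surj s : exists x, fiber_snd x = s.
Proof.
have [r _ rs] := surjR (I : [set: T] (epsS s)).
have rs' : (r, s) \in fiber_pred epsR epsS by rewrite inE /= rs.
by exists (FiberProduct rs').
Qed.

(* The two kernels have zero product, so a chain of primes of the fiber product
   lives over [R] or over [S]. *)
Lemma fiber_prime_chain n : strict_chain (@prime_ideal A) n ->
  strict_chain (@prime_ideal R) n \/ strict_chain (@prime_ideal S) n.
Proof.
move=> [c [c1 c2]].
have [H|/existsNP [x /not_implyP [x0 nx]]] :=
  pselect (forall x, fiber_fst x = 0 -> c 0%N x).
  by left; exact: (strict_chain_image (f := fiber_fst) fiber_fst_surj c1 c2 H).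
right; apply: (strict_chain_image (f := fiber_snd) fiber_snd_surj c1 c2).
move=> y y0; have /prime_idealP [id0 _ cM] := c1 0%N (leq0n n).
have xy : x * y = 0.
  apply: val_inj; rewrite (rmorphM val_fiber) (rmorph0 val_fiber).
  apply: injective_projections; rewrite /=.
    by rewrite -/(fiber_fst x) x0 mul0r.
  by rewrite -/(fiber_snd y) y0 mulr0.
by have [] : c 0%N x \/ c 0%N y by apply: cM; rewrite xy; apply: ideal0.
Qed.

(** Both dimensions are positive, hence attained maxima that bound all prime chains; the default
    value [0] would bound nothing. *)
Lemma fiber_krull_dim : (0 < krull_dim S)%N -> (krull_dim S < krull_dim R)%N ->
  krull_dim A = krull_dim R.
Proof.
move=> S0 SR; have R0 : (0 < krull_dim R)%N := ltn_trans S0 SR.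
have [chR maxR] := max_nat_gt0 R0; have [_ maxS] := max_nat_gt0 S0.
apply: max_nat_eq.
  apply: (strict_chain_preimage (f := fiber_fst)) chR; first exact: fiber_fst_surj.
  exact: prime_preimage.
move=> n /fiber_prime_chain [/maxR //|/maxS nS].
by apply: leq_trans nS (ltnW SR).
Qed.

End FiberProduct.

Theorem theorem1p2 (F : realType) (p : nat) (R S T : comNzRingType)
  (k : fieldType) (mR : set R) (mS : set S) (mT : set T)
  (epsR : {rmorphism R -> T}) (epsS : {rmorphism S -> T}) (s : F)
  (hR : local_ring mR k) (hS : local_ring mS k) (hT : local_ring mT k)
  (pR : p \in [pchar R]) (pS : p \in [pchar S]) (pT : p \in [pchar T])
  (surjR : set_surj [set: R] [set: T] epsR)
  (surjS : set_surj [set: S] [set: T] epsS)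
  (s_gt0 : 0 < s)
  (dimRS : (krull_dim S < krull_dim R)%N)
  (dimST : (krull_dim T < krull_dim S)%N)
  (cmR : cohen_macaulay mR)
  (e_s : F)
  (e_sE : is_s_multiplicity p s (@fiber_ideal R S T epsR epsS mR mS) e_s) :
  1 <= e_s.
Proof.
have S0 : (0 < krull_dim S)%N by apply: leq_ltn_trans dimST.
have R0 : (0 < krull_dim R)%N by apply: ltn_trans dimRS.
have dimA := fiber_krull_dim surjR surjS S0 dimRS.
have p1 : (1 < p)%N by have /andP[/prime_gt1] := pR.
have [h hE ->] := e_sE; rewrite dimA.
have [c Hc] := cohen_macaulay_bound hR pR cmR R0.
have idm := local_ring_ideal hR.
(* Since [H_s] is positive, the claim becomes [H_s <= h], an inequality of limits that is checked
   for each [e]. *)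
rewrite ler_pdivlMr ?mul1r; last exact: (H_s_gt0 c p1 R0 s_gt0).
rewrite -lee_fin.
have cvgH : (((box_sum (p ^ e) (krull_dim R) (ceil_nat s (p ^ e) - c))%:R *
    ((p ^ e)%:R)^-1 ^+ krull_dim R)%:E : \bar F) @[e --> \oo]
    --> (H_s s (krull_dim R))%:E.
  apply: cvg_EFin; first by apply: nearW => e.
  exact: (cvg_box_sum c p1 R0 s_gt0).
apply: (lee_cvg_to cvgH hE); apply: nearW => e.
rewrite /hs_seq dimA.
have -> : ((p ^ e)%:R)^-1 ^+ krull_dim R = ((p ^ (e * krull_dim R))%:R)^-1 :> F.
  by rewrite exprVn -natrX -expnM.
rewrite EFinM; apply: lee_wpmul2r; first by rewrite lee_fin invr_ge0.
pose n := ceil_nat s (p ^ e).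
pose I := ideal_add (ideal_pow mR n) (frobenius_pow mR (p ^ e)).
have idI : ideal I.
  by apply: ideal_ideal_add; [exact: ideal_ideal_pow|exact: ideal_span_ideal].
apply: (@quot_length_ge_nat F _ _ (@fiber_fst R S T epsR epsS) mR n _ I) => //.
- exact: fiber_fst_surj.
- move=> a; suff : submod_scale (V := (fiber_product epsR epsS)^o)
      (ideal_add (ideal_pow (fiber_ideal mR mS) n)
        (frobenius_pow (fiber_ideal mR mS) (p ^ e))) [set: _] `<=`
      (@fiber_fst R S T epsR epsS) @^-1` I by apply.
  apply: ideal_mul_sub; first exact: ideal_preimage.
  move=> x y Ix _; apply: ideal_mull; first exact: ideal_preimage.
  move: x Ix; apply: rmorph_ideal_add.
  + by apply: rmorph_ideal_pow => x [].
  + by apply: rmorph_frobenius_pow => x [].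
- by apply: sub_ideal_addl; apply: ideal_span_ideal.
move=> l Hl; have [cn|nc] := leqP c n.
  by apply: Hc; rewrite subnK.
(* For the finitely many small [q] with [n < c] the box count is empty. *)
have -> : (n - c = 0)%N by apply/eqP; rewrite subn_eq0 ltnW.
by rewrite /box_sum big_geq.
Qed.
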